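(* The group \[K_2=\langle x,t \mid [x,\ txt^{-1}\,x\,tx^{-1}t^{-1}],\ t^2\rangle,\] which is a one-relator product of the cyclic groups $\mathbb{Z}=\langle x\rangle$ and $C_2=\langle t\mid t^2\rangle$, i.e. of the form $(\mathbb{Z}*C_2)/\langle\langle r\rangle\rangle$, has undecidable Diophantine problem.
   Context: Commutator convention: $[u,v]=uvu^{-1}v^{-1}$. The Diophantine problem for a finitely generated group $G$ asks for an algorithm that, given a finite system of equations over $G$ (elements of $G*F(\mathcal X)$ for a finite set of variables $\mathcal X$), decides whether there is a homomorphism $G*F(\mathcal X)\to G$ restricting to the identity on $G$ and sending each equation to $1$. *)

(* Defs.v *)
From HB Require Import structures.
From mathcomp Require Import all_boot.
Set Implicit Arguments. Unset Strict Implicit. Unset Printing Implicit Defensive.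

(* A letter is (a, b) with a : A a generator, b = true meaning a^-1. *)
Definition word (A : Type) := seq (A * bool).
Definition letter_inv (A : Type) (l : A * bool) : A * bool := (l.1, ~~ l.2).
Definition word_inv (A : Type) (w : word A) : word A := rev (map (@letter_inv A) w).

Inductive pres_step (A : eqType) (R : seq (word A)) : word A -> word A -> Prop :=
| ps_free u v l : pres_step R (u ++ v) (u ++ [:: l; letter_inv l] ++ v)
| ps_rel u v r : r \in R -> pres_step R (u ++ v) (u ++ r ++ v)
| ps_relinv u v r : r \in R -> pres_step R (u ++ v) (u ++ word_inv r ++ v)
| ps_sym w1 w2 : pres_step R w1 w2 -> pres_step R w2 w1.

Inductive pres_eq (A : eqType) (R : seq (word A)) : word A -> word A -> Prop :=
| pe_refl w : pres_eq R w w
| pe_step w1 w2 w3 : pres_step R w1 w2 -> pres_eq R w2 w3 -> pres_eq R w1 w3.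

Inductive K2gen := gx | gt.
Definition K2gen_to_bool (g : K2gen) : bool := if g is gt then true else false.
Definition bool_to_K2gen (b : bool) : K2gen := if b then gt else gx.
Lemma K2gen_boolK : cancel K2gen_to_bool bool_to_K2gen. Proof. by case. Qed.
HB.instance Definition _ := Equality.copy K2gen (can_type K2gen_boolK).
HB.instance Definition _ := Choice.copy K2gen (can_type K2gen_boolK).
HB.instance Definition _ := Countable.copy K2gen (can_type K2gen_boolK).

Definition X : K2gen * bool := (gx, false).
Definition Xi : K2gen * bool := (gx, true).
Definition T : K2gen * bool := (gt, false).
Definition Ti : K2gen * bool := (gt, true).

(* v = t x t^-1 x t x^-1 t^-1 ; commutator convention [u,v] = u v u^-1 v^-1 *)
Definition K2_v : word K2gen := [:: T; X; Ti; X; T; Xi; Ti].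
Definition K2_rel1 : word K2gen := [:: X] ++ K2_v ++ [:: Xi] ++ word_inv K2_v.
Definition K2_rel2 : word K2gen := [:: T; T].
Definition K2_rels : seq (word K2gen) := [:: K2_rel1; K2_rel2].

(* An equation is an element of K_2 * F(X), X = variables indexed by nat
   (each equation, hence each finite system, involves finitely many). *)
Definition eq_letter := (K2gen + nat)%type.
Definition equation := word eq_letter.
Definition eq_system := seq equation.

(* Substitution of an assignment of the variables (the homomorphism
   K_2 * F(X) -> K_2 that is the identity on K_2). *)
Definition subst_letter (s : nat -> word K2gen) (l : eq_letter * bool) : word K2gen :=
  match l with
  | (inl g, b) => [:: (g, b)]
  | (inr i, false) => s i
  | (inr i, true) => word_inv (s i)
  end.
Definition subst (s : nat -> word K2gen) (w : equation) : word K2gen :=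
  flatten (map (subst_letter s) w).

Definition K2_solvable (S : eq_system) : Prop :=
  exists s : nat -> word K2gen, forall e, e \in S -> pres_eq K2_rels (subst s e) [::].

Inductive recfun :=
| RZero
| RSucc
| RProj of nat
| RComp of recfun & seq recfun
| RPrim of recfun & recfun
| RMu of recfun.

Inductive evalrf : recfun -> seq nat -> nat -> Prop :=
| ev_zero v : evalrf RZero v 0
| ev_succ n v : evalrf RSucc (n :: v) n.+1
| ev_proj i v : i < size v -> evalrf (RProj i) v (nth 0 v i)
| ev_comp f gs v ws y : evalrfs gs v ws -> evalrf f ws y -> evalrf (RComp f gs) v y
| ev_prim0 f g v y : evalrf f v y -> evalrf (RPrim f g) (0 :: v) y
| ev_primS f g n v y z : evalrf (RPrim f g) (n :: v) y ->
    evalrf g (n :: y :: v) z -> evalrf (RPrim f g) (n.+1 :: v) z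
| ev_mu f v n : evalrf f (n :: v) 0 ->
    (forall m, m < n -> exists k, evalrf f (m :: v) k.+1) -> evalrf (RMu f) v n
with evalrfs : seq recfun -> seq nat -> seq nat -> Prop :=
| evs_nil v : evalrfs [::] v [::]
| evs_cons g gs v y ys : evalrf g v y -> evalrfs gs v ys -> evalrfs (g :: gs) v (y :: ys).

(* A predicate on a countable type is decidable if some partial recursive
   function, applied to the (computable) code pickle s, halts with 1 on
   instances satisfying P and with 0 on the others. *)
Definition rec_decidable (Tc : countType) (P : Tc -> Prop) : Prop :=
  exists f : recfun, forall s : Tc,
    (P s -> evalrf f [:: pickle s] 1) /\ (~ P s -> evalrf f [:: pickle s] 0).

Definition K2_diophantine_decidable : Prop := rec_decidable K2_solvable.

(* Main.v *)
From mathcomp Require Import all_boot all_order all_algebra zify ring.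
From Stdlib Require Import FunctionalExtensionality Setoid Morphisms.
Require Import Defs.
Set Implicit Arguments. Unset Strict Implicit. Unset Printing Implicit Defensive.
Import Order.TTheory GRing.Theory Num.Theory.

(** Put [y = t x t^-1].  The relator says that [x] commutes with [y x y^-1], and its conjugate by [t]
    that [y] commutes with [x y x^-1]; so [z = [x, y]] is central in [<x, y>], and [K_2] is the
    integral Heisenberg group extended by the involution [t], which swaps [x] and [y].  The
    centralizer of [x] is [{x^a z^c}], and [[x^a z^*, y^b z^*] = z^(ab)]: with [t] available to turn
    [x^b] into [y^b], systems of equations over [K_2] express addition and multiplication of integers.
    Natural numbers are singled out inside the integers by sums of four squares.

    It remains to see that graphs of partial recursive functions are Diophantine.  Exponentiation
    comes from Matiyasevich's analysis of [alpha_b(n+2) = b alpha_b(n+1) - alpha_b(n)]; binomial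
    coefficients are digits of [(1+B)^n], factorials are quotients [r^w / C(r,w)], and a bounded universal
    quantifier is eliminated by the Chinese remainder theorem with moduli [L/(k+1) - 1],
    [L = w!^2], whose product is [C(L-1, n)].

    Undecidability follows by diagonalization.  If [f] decided solvability, the set of [k] such that
    [f] outputs [0] on the system coded by [k], augmented by the equation [v_0 = x^k], would be
    Diophantine, hence defined by some system [S] in the parameter [v_0]; for [k] the code of [S]
    the augmented system is solvable iff [f] says that it is not. *)

(** * Diophantine predicates *)

Inductive constr :=
| EOne of nat
| EAdd of nat & nat & nat
| EMul of nat & nat & nat.

Definition interleave (D : Type) (u w : nat -> D) (i : nat) : D :=
  if odd i then w i./2 else u i./2.

Lemma interleave_double (D : Type) (u w : nat -> D) i : interleave u w i.*2 = u i.
Proof. by rewrite /interleave odd_double doubleK. Qed.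

Lemma interleave_doubleS (D : Type) (u w : nat -> D) i : interleave u w i.*2.+1 = w i.
Proof. by rewrite /interleave /= odd_double /= uphalf_double. Qed.

Lemma interleave_split (D : Type) (v : nat -> D) :
  interleave (fun i => v i.*2) (fun i => v i.*2.+1) = v.
Proof.
apply: functional_extensionality => i; rewrite /interleave.
by case: ifP (odd_double_half i) => _; rewrite ?add1n ?add0n => ->.
Qed.

Definition rename (r : nat -> nat) (c : constr) : constr :=
  match c with
  | EOne i => EOne (r i)
  | EAdd i j k => EAdd (r i) (r j) (r k)
  | EMul i j k => EMul (r i) (r j) (r k)
  end.

Section Diophantine.
Variables (D : Type) (one : D) (add mul : D -> D -> D).
Implicit Types (nu mu : nat -> D) (P : (nat -> D) -> Prop) (l : seq constr).

Definition holds nu (c : constr) : Prop :=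
  match c with
  | EOne i => nu i = one
  | EAdd i j k => add (nu i) (nu j) = nu k
  | EMul i j k => mul (nu i) (nu j) = nu k
  end.

Fixpoint sat nu l : Prop := if l is c :: l' then holds nu c /\ sat nu l' else True.

(** Parameters sit at even positions and unknowns at odd ones. Both are infinite sequences, so no
    arity has to be tracked; a finite list of constraints mentions only finitely many of them. *)
Definition dio P : Prop := exists l, forall nu, P nu <-> exists mu, sat (interleave nu mu) l.
Definition dfun (f : (nat -> D) -> D) : Prop :=
  dio (fun nu => nu 0 = f (fun i => nu i.+1)).

Lemma sat_cat nu l1 l2 : sat nu (l1 ++ l2) <-> sat nu l1 /\ sat nu l2.
Proof. by elim: l1 => [|c l1 IH] /=; tauto. Qed.

Lemma sat_rename r nu l : sat nu (map (rename r) l) <-> sat (fun i => nu (r i)) l.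
Proof. by elim: l => [|c l IH] //=; rewrite IH; case: c. Qed.

Lemma dio_iff P Q : dio P -> (forall nu, P nu <-> Q nu) -> dio Q.
Proof. by move=> [l Hl] PQ; exists l => nu; rewrite -PQ. Qed.

Lemma dio_ren (r : nat -> nat) P : dio P -> dio (fun nu => P (fun i => nu (r i))).
Proof.
move=> [l Hl]; pose r' i := if odd i then i else (r i./2).*2.
have E nu mu : (fun i => interleave nu mu (r' i)) = interleave (fun i => nu (r i)) mu.
  apply: functional_extensionality => i; rewrite /r' {2}/interleave.
  by case: ifP => oi; rewrite ?interleave_double // /interleave oi.
exists (map (rename r') l) => nu.
by rewrite Hl; split=> -[mu H]; exists mu; move: H; rewrite sat_rename E.
Qed.

Lemma dio_exf (Q : (nat -> D) -> (nat -> D) -> Prop) :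
  dio (fun nu => Q (fun i => nu i.*2.+1) (fun i => nu i.*2)) ->
  dio (fun nu => exists mu, Q mu nu).
Proof.
move=> [l Hl].
(* Parameter j moves from position 4j to 2j, component j of the quantified sequence from 4j+2 to
   4j+1, and unknown j of [l] from 2j+1 to 4j+3. *)
pose r i := if odd i then i.*2.+1 else
  if odd i./2 then (i./2)./2.*2.*2.+1 else i./2.
exists (map (rename r) l) => nu.
have E mu la : (fun i => interleave nu (interleave mu la) (r i)) = interleave (interleave nu mu) la.
  apply: functional_extensionality => i; rewrite /r {3 4}/interleave.
  case: ifP => oi; first by rewrite interleave_doubleS /interleave oi.
  case: ifP => oi2; first by rewrite interleave_doubleS interleave_double.
  by rewrite /interleave oi2.
have F mu : Q mu nu <-> exists la, sat (interleave (interleave nu mu) la) l.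
  rewrite -Hl.
  have -> : (fun i => interleave nu mu i.*2.+1) = mu.
    by apply: functional_extensionality => i; rewrite interleave_doubleS.
  have -> // : (fun i => interleave nu mu i.*2) = nu.
  by apply: functional_extensionality => i; rewrite interleave_double.
split=> [[mu /F[la]]|[ka]].
  by exists (interleave mu la); rewrite sat_rename E.
rewrite sat_rename -(interleave_split ka) E => H.
by eexists; apply/F; eexists; exact: H.
Qed.

Lemma dio_ex (Q : D -> (nat -> D) -> Prop) :
  dio (fun nu => Q (nu 0) (fun i => nu i.+1)) -> dio (fun nu => exists x, Q x nu).
Proof.
move=> /(dio_ren (fun i => if i is j.+1 then j.*2 else 1)) H.
apply: (@dio_iff (fun nu => exists mu : nat -> D, Q (mu 0) nu)); first exact: dio_exf.
by move=> nu; split=> [[mu]|[x]]; [exists (mu 0)|exists (fun=> x)].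
Qed.

Lemma dio_and P Q : dio P -> dio Q -> dio (fun nu => P nu /\ Q nu).
Proof.
move=> [l1 H1] [l2 H2].
pose r1 i := if odd i then i./2.*2.*2.+1 else i.
pose r2 i := if odd i then i./2.*2.+1.*2.+1 else i.
exists (map (rename r1) l1 ++ map (rename r2) l2) => nu.
have E1 m1 m2 : (fun i => interleave nu (interleave m1 m2) (r1 i)) = interleave nu m1.
  apply: functional_extensionality => i; rewrite /r1 {3}/interleave.
  by case: ifP => oi; rewrite ?interleave_doubleS ?interleave_double // /interleave oi.
have E2 m1 m2 : (fun i => interleave nu (interleave m1 m2) (r2 i)) = interleave nu m2.
  apply: functional_extensionality => i; rewrite /r2 {3}/interleave.
  by case: ifP => oi; rewrite ?interleave_doubleS ?interleave_double // /interleave oi.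
rewrite H1 H2; split=> [[[m1 S1] [m2 S2]]|[ka]].
  by exists (interleave m1 m2); rewrite sat_cat !sat_rename E1 E2.
rewrite -(interleave_split ka) sat_cat !sat_rename E1 E2 => -[S1 S2].
by split; eexists; eauto.
Qed.

Lemma dio_true : dio (fun=> True).
Proof. by exists [::] => nu; split=> // _; exists nu. Qed.

Lemma dio_holds c : dio (fun nu => holds nu c).
Proof.
exists [:: rename double c] => nu; split=> [H|[mu [+ _]]].
  by exists nu; split=> //; case: c H => [i|i j k|i j k] /=; rewrite !interleave_double.
by case: c => [i|i j k|i j k] /=; rewrite !interleave_double.
Qed.

Lemma dio_forall_lt (P : nat -> (nat -> D) -> Prop) n :
  (forall i, dio (P i)) -> dio (fun nu => forall i, i < n -> P i nu).
Proof.
move=> H; elim: n => [|n IH]; first by apply: dio_iff dio_true _.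
apply: (dio_iff (dio_and IH (H n))) => nu; split=> [[H1 H2] i|H1].
  by rewrite ltnS leq_eqVlt => /predU1P[->|] //; apply: H1.
by split=> [i lin|]; apply: H1 => //; apply: ltnW.
Qed.

(** A compound term is named by a fresh variable at position 0, which shifts the parameters up by
    one. All closure under composition rests on this. *)
Lemma dio_let (Q : D -> (nat -> D) -> Prop) f :
  dfun f -> dio (fun nu => Q (nu 0) (fun i => nu i.+1)) -> dio (fun nu => Q (f nu) nu).
Proof.
move=> Hf HQ; apply: (@dio_iff (fun nu => exists x, x = f nu /\ Q x nu)).
  exact: dio_ex (dio_and Hf HQ).
by move=> nu; split=> [[x [-> //]]|]; exists (f nu).
Qed.

Lemma dfun_ren (r : nat -> nat) f : dfun f -> dfun (fun nu => f (fun i => nu (r i))).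
Proof. by move=> /(dio_ren (fun i => if i is j.+1 then (r j).+1 else 0)). Qed.

Lemma dio_rel2 (R : D -> D -> Prop) f g : dio (fun nu => R (nu 0) (nu 1)) ->
  dfun f -> dfun g -> dio (fun nu => R (f nu) (g nu)).
Proof.
move=> HR Hf Hg; apply: (dio_let (Q := fun x nu => R x (g nu))) => //.
apply: (dio_let (Q := fun x nu => R (nu 0) x)); first exact: dfun_ren.
exact: (dio_ren (fun i => if i is 0 then 1 else 0)) HR.
Qed.

Lemma dfun_op2 (h : D -> D -> D) f g : dfun (fun nu => h (nu 0) (nu 1)) ->
  dfun f -> dfun g -> dfun (fun nu => h (f nu) (g nu)).
Proof.
move=> Hh Hf Hg; apply: (dio_let (Q := fun x nu => nu 0 = h x (g (fun i => nu i.+1)))).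
  exact: dfun_ren.
apply: (dio_let (Q := fun x nu => nu 1 = h (nu 0) x)); first exact: (dfun_ren (fun i => i.+2)).
exact: (dio_ren (fun i => match i with 0 => 2 | 1 => 1 | _ => 0 end)) Hh.
Qed.

Lemma dfun_op1 (h : D -> D) f : dfun (fun nu => h (nu 0)) ->
  dfun f -> dfun (fun nu => h (f nu)).
Proof.
move=> Hh Hf; apply: (dio_let (Q := fun x nu => nu 0 = h x)); first exact: dfun_ren.
exact: (dio_ren (fun i => if i is 0 then 1 else 0)) Hh.
Qed.

Hypothesis mul_one : forall x, mul x one = x.

Lemma dio_eq_var i j : dio (fun nu => nu i = nu j).
Proof.
apply: (@dio_iff (fun nu => exists o, o = one /\ mul (nu i) o = nu j)).
  apply: dio_ex; apply: dio_and; first exact: (dio_holds (EOne 0)).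
  exact: (dio_holds (EMul i.+1 0 j.+1)).
by move=> nu; split=> [[o [->]]|H]; [rewrite mul_one|exists one; rewrite mul_one].
Qed.

Lemma dfun_var i : dfun (fun nu => nu i).
Proof. exact: dio_eq_var. Qed.

Lemma dio_eq f g : dfun f -> dfun g -> dio (fun nu => f nu = g nu).
Proof. exact/dio_rel2/dio_eq_var. Qed.

Lemma dfun_one : dfun (fun=> one).
Proof. exact: (dio_holds (EOne 0)). Qed.

Lemma dfun_add f g : dfun f -> dfun g -> dfun (fun nu => add (f nu) (g nu)).
Proof.
apply: dfun_op2; apply: dio_iff (dio_holds (EAdd 1 2 0)) _ => nu /=.
by split=> ->.
Qed.

Lemma dfun_mul f g : dfun f -> dfun g -> dfun (fun nu => mul (f nu) (g nu)).
Proof.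
apply: dfun_op2; apply: dio_iff (dio_holds (EMul 1 2 0)) _ => nu /=.
by split=> ->.
Qed.

End Diophantine.

(** * Diophantine predicates and functions over the natural numbers *)

Notation ndio := (@dio nat 1 addn muln).
Notation nfun := (@dfun nat 1 addn muln).

Lemma nfun_var i : nfun (fun nu => nu i).
Proof. exact: dfun_var muln1 i. Qed.

Lemma nfun_add f g : nfun f -> nfun g -> nfun (fun nu => f nu + g nu).
Proof. exact: dfun_add. Qed.

Lemma nfun_mul f g : nfun f -> nfun g -> nfun (fun nu => f nu * g nu).
Proof. exact: dfun_mul. Qed.

Lemma ndio_eq f g : nfun f -> nfun g -> ndio (fun nu => f nu = g nu).
Proof. exact: dio_eq muln1 f g. Qed.

Lemma nfun_const n : nfun (fun=> n).
Proof.
elim: n => [|n IH]; last first.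
  apply: dio_iff (nfun_add IH (dfun_one _ _ _)) _ => nu /=.
  by rewrite addn1.
(* Zero is the only solution of [x + x = x]. *)
by apply: dio_iff (dio_holds 1 addn muln (EAdd 0 0 0)) _ => nu /=; lia.
Qed.

Lemma nfun_succ f : nfun f -> nfun (fun nu => (f nu).+1).
Proof.
move=> Hf; apply: dio_iff (nfun_add Hf (nfun_const 1)) _ => nu /=.
by rewrite addn1.
Qed.

Lemma ndio_le f g : nfun f -> nfun g -> ndio (fun nu => f nu <= g nu).
Proof.
apply: (@dio_rel2 _ _ _ _ (fun x y => x <= y)).
apply: (@dio_iff _ _ _ _ (fun nu => exists z, nu 0 + z = nu 1)); last first.
  by move=> nu; split=> [[z]|H]; [lia|exists (nu 1 - nu 0); lia].
apply: dio_ex; apply: ndio_eq; last exact: nfun_var.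
by apply: nfun_add; apply: nfun_var.
Qed.

Lemma ndio_lt f g : nfun f -> nfun g -> ndio (fun nu => f nu < g nu).
Proof. by move=> Hf Hg; apply: ndio_le => //; apply: nfun_succ. Qed.

(** Two multipliers avoid subtraction, so that the form is visibly Diophantine over the naturals. *)
Definition congn (m a b : nat) := exists u v, a + u * m = b + v * m.

Lemma congnP m a b : congn m a b <-> a = b %[mod m].
Proof.
split=> [[u [v H]]|H].
  by rewrite -(modnMDl u a m) -(modnMDl v b m) addnC H addnC.
exists (b %/ m), (a %/ m).
by rewrite {1}(divn_eq a m) {2}(divn_eq b m) H; lia.
Qed.

(** A hook of [nfun_tac], rebound with [::=] to the Diophantine functions that the lemmas after each
    rebinding need. *)
Ltac nfun_ext := fail.
Ltac nfun_tac := lazy beta; match goal with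
 | |- dfun _ _ _ (fun _ => ?c) => refine (nfun_const c)
 | |- dfun _ _ _ (fun nu => nu ?i) => refine (nfun_var i)
 | |- dfun _ _ _ (fun nu => S (@?f nu)) => refine (nfun_succ (f := f) _); nfun_tac
 | |- dfun _ _ _ (fun nu => addn (@?f nu) (@?g nu)) =>
     refine (nfun_add (f := f) (g := g) _ _); nfun_tac
 | |- dfun _ _ _ (fun nu => muln (@?f nu) (@?g nu)) =>
     refine (nfun_mul (f := f) (g := g) _ _); nfun_tac
 | H : dfun _ _ _ ?f |- dfun _ _ _ (fun nu => ?f _) => exact (dfun_ren _ H)
 | H : dfun _ _ _ ?f |- dfun _ _ _ ?f => exact H
 | _ => nfun_ext; nfun_tac
 | _ => idtac
 end.
Ltac ndio_ext := fail.
Ltac ndio_tac := lazy beta; match goal with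
 | |- dio _ _ _ (fun nu => (@?P nu) /\ (@?Q nu)) =>
     refine (dio_and (P := P) (Q := Q) _ _); ndio_tac
 | |- dio _ _ _ (fun nu => exists x, @?Q nu x) =>
     refine (dio_ex (Q := fun x nu => Q nu x) _); ndio_tac
 | |- dio _ _ _ (fun nu => @?f nu = @?g nu) =>
     refine (ndio_eq (f := f) (g := g) _ _); nfun_tac
 | |- dio _ _ _ (fun nu => is_true (leq (S (@?f nu)) (@?g nu))) =>
     refine (ndio_lt (f := f) (g := g) _ _); nfun_tac
 | |- dio _ _ _ (fun nu => is_true (leq (@?f nu) (@?g nu))) =>
     refine (ndio_le (f := f) (g := g) _ _); nfun_tac
 | _ => ndio_ext; ndio_tac
 | _ => idtac
 end.

Lemma ndio_congn h f g : nfun h -> nfun f -> nfun g ->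
  ndio (fun nu => congn (h nu) (f nu) (g nu)).
Proof. by move=> Hh Hf Hg; rewrite /congn; ndio_tac. Qed.

Lemma ndio_dvd f g : nfun f -> nfun g -> ndio (fun nu => f nu %| g nu).
Proof.
move=> Hf Hg; apply: (@dio_iff _ _ _ _ (fun nu => exists z, g nu = z * f nu)).
  by ndio_tac.
by move=> nu; split=> /dvdnP.
Qed.

Lemma nfun_divn f g : nfun f -> nfun g -> (forall nu, 0 < g nu) -> nfun (fun nu => f nu %/ g nu).
Proof.
move=> Hf Hg g0; rewrite /dfun.
apply: (@dio_iff _ _ _ _ (fun nu => exists r, f (fun i => nu i.+1) = nu 0 * g (fun i => nu i.+1) + r
  /\ r < g (fun i => nu i.+1))); first by ndio_tac.
move=> nu; have g0' := g0 (fun i => nu i.+1).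
split=> [[r [-> H]]|->]; first by rewrite divnMDl // divn_small ?addn0.
by eexists; split; [exact: divn_eq|rewrite ltn_mod].
Qed.

Lemma nfun_modn f g : nfun f -> nfun g -> (forall nu, 0 < g nu) -> nfun (fun nu => f nu %% g nu).
Proof.
move=> Hf Hg g0; rewrite /dfun.
apply: (@dio_iff _ _ _ _ (fun nu => exists q, f (fun i => nu i.+1) = q * g (fun i => nu i.+1) + nu 0
  /\ nu 0 < g (fun i => nu i.+1))); first by ndio_tac.
move=> nu; have g0' := g0 (fun i => nu i.+1).
split=> [[r [-> H]]|->]; first by rewrite modnMDl modn_small.
by eexists; split; [exact: divn_eq|rewrite ltn_mod].
Qed.

Ltac ndio_ext ::= match goal with
 | |- dio _ _ _ (fun nu => congn (@?h nu) (@?f nu) (@?g nu)) =>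
     refine (ndio_congn (h := h) (f := f) (g := g) _ _ _); nfun_tac
 | |- dio _ _ _ (fun nu => is_true (dvdn (@?f nu) (@?g nu))) =>
     refine (ndio_dvd (f := f) (g := g) _ _); nfun_tac
 end.

(** * Lucas sequences and exponentiation *)

Section LucasSequence.
Local Open Scope ring_scope.
Implicit Types (b c d u v : int) (m n k l : nat).

(** Pairs of consecutive terms make the second-order recurrence structural. The first component is
    the Lucas sequence U_n(b, 1), Matiyasevich's alpha_b(n). *)
Fixpoint lucas2 b n : int * int :=
  if n is m.+1 then ((lucas2 b m).2, b * (lucas2 b m).2 - (lucas2 b m).1) else (0, 1).
Definition lucas b n : int := (lucas2 b n).1.

Lemma lucas0 b : lucas b 0 = 0. Proof. by []. Qed.
Lemma lucas1 b : lucas b 1 = 1. Proof. by []. Qed.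
Lemma lucasSS b n : lucas b n.+2 = b * lucas b n.+1 - lucas b n. Proof. by []. Qed.

Lemma lucas_addS b m n :
  lucas b (m + n).+1 = lucas b m.+1 * lucas b n.+1 - lucas b m * lucas b n.
Proof.
elim: n m => [|n IH] m; first by rewrite addn0 lucas0 lucas1; ring.
by rewrite addnS -addSn IH !lucasSS; ring.
Qed.

Lemma lucas_add b m n :
  lucas b (m + n) = lucas b m.+1 * lucas b n + lucas b m * lucas b n.+1 - b * lucas b m * lucas b n.
Proof.
case: m => [|m]; first by rewrite add0n lucas0 lucas1; ring.
by rewrite addSn lucas_addS !lucasSS; ring.
Qed.

Lemma lucas_quad b n :
  lucas b n.+1 ^+ 2 - b * lucas b n.+1 * lucas b n + lucas b n ^+ 2 = 1.
Proof. by elim: n => [|n <-]; rewrite ?lucas0 ?lucas1 ?lucasSS; ring. Qed.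

Lemma lucas_mono b n : 2 <= b -> 0 <= lucas b n /\ lucas b n + 1 <= lucas b n.+1.
Proof.
move=> b2; elim: n => [|n [IH1 IH2]]; first by rewrite lucas0 lucas1.
by rewrite lucasSS; split; nia.
Qed.

Lemma lucas_ge0 b n : 2 <= b -> 0 <= lucas b n.
Proof. by move=> b2; case: (lucas_mono n b2). Qed.

Lemma lucas_geid b n : 2 <= b -> n%:Z <= lucas b n.
Proof. by move=> b2; elim: n => [|n IH] //; have := lucas_mono n b2; lia. Qed.

Lemma lucas_leq b m n : 2 <= b -> (m <= n)%N -> lucas b m <= lucas b n.
Proof.
move=> b2; elim: n => [|n IH]; first by case: m.
rewrite leq_eqVlt => /predU1P[-> //|/IH H].
by have := lucas_mono n b2; lia.
Qed.

Lemma lucas_lt b m n : 2 <= b -> (m < n)%N -> lucas b m < lucas b n.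
Proof. by move=> b2 /(lucas_leq b2); have := lucas_mono m b2; lia. Qed.

(** Descent: the pair (bt - u, t) satisfies the same equation, and u (bt - u) = t^2 - 1 makes it
    smaller while t > 0. Running the recurrence backwards ends at (0, 1). *)
Lemma lucas_complete_le b (t u : nat) : 2 <= b -> (t <= u)%N ->
  u%:Z ^+ 2 - b * u%:Z * t%:Z + t%:Z ^+ 2 = 1 ->
  exists n, u%:Z = lucas b n.+1 /\ t%:Z = lucas b n.
Proof.
move=> b2; elim/ltn_ind: t u => t IH u tu E.
case: (posnP t) => [t0|t0].
  by exists 0%N; rewrite lucas0 lucas1; subst t; split=> //; nia.
have u0 : (0 < u)%N by lia.
have E1 : u%:Z * (b * t%:Z - u%:Z) = t%:Z ^+ 2 - 1 by rewrite -E; ring.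
have p0 : 0 <= b * t%:Z - u%:Z by nia.
have p1 : b * t%:Z - u%:Z < t%:Z by nia.
have [r rE] : exists r : nat, r%:Z = b * t%:Z - u%:Z.
  by case: (b * t%:Z - u%:Z) p0 => // r _; exists r.
have [n [n1 n2]] : exists n, t%:Z = lucas b n.+1 /\ r%:Z = lucas b n.
  by apply: IH; [lia|lia|rewrite rE -E; ring].
by exists n.+1; rewrite lucasSS -n1 -n2 rE; split=> //; ring.
Qed.

Lemma lucas_complete b (u t : nat) : 2 <= b ->
  u%:Z ^+ 2 - b * u%:Z * t%:Z + t%:Z ^+ 2 = 1 -> exists n, u%:Z = lucas b n.
Proof.
move=> b2 E; case: (leqP t u) => [tu|/ltnW ut].
  by have [n [H _]] := lucas_complete_le b2 tu E; exists n.+1.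
have [|n [_ H]] := lucas_complete_le b2 ut; first by rewrite -E; ring.
by exists n.
Qed.

Lemma lucas_congr b c n : (b - c %| lucas b n - lucas c n)%Z.
Proof.
suff [] : (b - c %| lucas b n - lucas c n)%Z /\ (b - c %| lucas b n.+1 - lucas c n.+1)%Z by [].
elim: n => [|n [IH1 IH2]]; first by rewrite !lucas0 !lucas1 !subrr !dvdz0.
split=> //; rewrite !lucasSS.
have -> : b * lucas b n.+1 - lucas b n - (c * lucas c n.+1 - lucas c n)
  = b * (lucas b n.+1 - lucas c n.+1) + (b - c) * lucas c n.+1 - (lucas b n - lucas c n) by ring.
by apply: rpredB => //; apply: rpredD; [exact: dvdz_mull|exact: dvdz_mulr].
Qed.

Lemma lucas_two n : lucas 2 n = n%:Z.
Proof.
suff [] : lucas 2 n = n%:Z /\ lucas 2 n.+1 = n.+1%:Z by [].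
by elim: n => [|n [IH1 IH2]] //; split=> //; rewrite lucasSS IH1 IH2; lia.
Qed.

(** If A^2 = bA - 1, then A^m = BA + g with B = [lucas b m] and g = [lucas b m.+1 - b * lucas b m].
    The formulas are the binomial expansion of (g + BA)^(k+1) modulo B^2. *)
Lemma lucas_muln b m k : exists e1 e2,
  lucas b (m * k.+1) = k.+1%:Z * lucas b m * (lucas b m.+1 - b * lucas b m) ^+ k
     + lucas b m ^+ 2 * e1 /\
  lucas b (m * k.+1).+1 = (lucas b m.+1 - b * lucas b m) ^+ k.+1
     + b * k.+1%:Z * lucas b m * (lucas b m.+1 - b * lucas b m) ^+ k + lucas b m ^+ 2 * e2.
Proof.
elim: k => [|k [e1 [e2 [E1 E2]]]].
  by exists 0, 0; rewrite muln1; split; ring.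
rewrite (mulnS m k.+1) addnC lucas_add lucas_addS E1 E2.
set B := lucas b m; set p := lucas b m.+1; set g := p - b * B.
have -> : p = g + b * B by rewrite /g; ring.
rewrite (_ : k.+2%:Z = k.+1%:Z + 1); last by lia.
exists (b * k.+1%:Z * g ^+ k + B * e2 + g * e1),
  (b ^+ 2 * k.+1%:Z * g ^+ k + (g + b * B) * e2 - k.+1%:Z * g ^+ k - B * e1).
by rewrite !exprS; split; ring.
Qed.

Lemma lucas_coprime b n d : (d %| lucas b n)%Z -> coprimez d (lucas b n.+1).
Proof.
move=> /dvdzP[q E]; apply/coprimezP.
exists (q * lucas b n, lucas b n.+1 - b * lucas b n) => /=.
by rewrite -(lucas_quad b n); have -> : q * lucas b n * d = lucas b n ^+ 2; rewrite ?E; ring.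
Qed.

Lemma lucas_dvd_mul b m k : (lucas b m %| lucas b (m * k))%Z.
Proof.
case: k => [|k]; first by rewrite muln0 lucas0 dvdz0.
have [e1 [e2 [-> _]]] := lucas_muln b m k.
by rewrite rpredD // dvdz_mulr // ?dvdz_exp // dvdz_mull.
Qed.

(** Write n = mk + r with r < m. Modulo [lucas b m] the term of index n is
    [lucas b (m * k).+1 * lucas b r], whose first factor is invertible; so [lucas b m] divides the
    smaller [lucas b r], which forces r = 0. *)
Lemma lucas_dvd b m n : 2 <= b -> (0 < m)%N -> (lucas b m %| lucas b n)%Z -> (m %| n)%N.
Proof.
move=> b2 m0; rewrite {1}(divn_eq n m) mulnC lucas_add.
set k := (n %/ m)%N; set r := (n %% m)%N => H.
have Hk := lucas_dvd_mul b m k.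
have : (lucas b m %| lucas b (m * k).+1 * lucas b r)%Z.
  have -> : lucas b (m * k).+1 * lucas b r =
     (lucas b (m * k).+1 * lucas b r + lucas b (m * k) * lucas b r.+1 - b * lucas b (m * k) * lucas b r)
     - lucas b (m * k) * (lucas b r.+1 - b * lucas b r) by ring.
  by rewrite rpredB // dvdz_mulr.
rewrite Gauss_dvdzr; last exact: lucas_coprime.
have rm : (r < m)%N by rewrite ltn_mod.
case: (posnP r) => [r0 _|r0 /dvdzP[q E]]; first by rewrite /dvdn -/r r0.
have := lucas_lt b2 rm; have := lucas_lt b2 r0; rewrite lucas0 => h1 h2.
have : 0 < q by nia.
by nia.
Qed.

(** By [lucas_dvd], n = m(k+1) unless n = 0. Modulo B^2 the term is (k+1) B g^k with g prime to B =
    [lucas b m], hence B divides k+1. *)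
Lemma lucas_sqr_dvd b m n : 2 <= b -> (0 < m)%N ->
  (lucas b m ^+ 2 %| lucas b n)%Z -> (lucas b m %| n%:Z)%Z.
Proof.
move=> b2 m0 H.
have /(lucas_dvd b2 m0)/dvdnP[k nE] : (lucas b m %| lucas b n)%Z.
  by apply: dvdz_trans H; rewrite dvdz_exp.
have B0 : lucas b m != 0 by have := lucas_lt b2 m0; rewrite lucas0; lia.
rewrite {}nE mulnC in H *; case: k H => [|k]; first by rewrite muln0 dvdz0.
have [e1 [e2 [-> _]]] := lucas_muln b m k.
rewrite rpredDr; last by rewrite dvdz_mulr.
rewrite -mulrA mulrCA expr2 dvdz_mul2l //.
rewrite Gauss_dvdzl; first by rewrite PoszM; apply: dvdz_mull.
rewrite coprimezXr //; apply/coprimezP; exists (lucas b m, lucas b m.+1) => /=.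
by rewrite -(lucas_quad b m); ring.
Qed.

Lemma lucas_sqr_dvd_mul b m k : (lucas b m %| k%:Z)%Z -> (lucas b m ^+ 2 %| lucas b (m * k))%Z.
Proof.
case: k => [|k] H; first by rewrite muln0 lucas0 dvdz0.
have [e1 [e2 [-> _]]] := lucas_muln b m k.
apply: rpredD; last exact: dvdz_mulr.
by apply: dvdz_mulr; rewrite expr2; apply: dvdz_mul.
Qed.

(** The factor [2 * lucas b l.+1 - b * lucas b l] is the companion term V_l, which equals q^l +
    q^(-l) when b = q + 1/q. *)
Lemma lucas_add_2l b n l :
  lucas b (n + l.*2) + lucas b n = (2 * lucas b l.+1 - b * lucas b l) * lucas b (n + l).
Proof.
rewrite -addnn !(lucas_add _ n) !(lucas_add _ l) !lucas_addS.
have := lucas_quad b l; set p := lucas b l.+1; set q := lucas b l.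
set r := lucas b n.+1; set s := lucas b n => E.
(* Multiplying by the quadratic form, whose value is 1, makes both sides homogeneous, so that [ring]
   applies. *)
have Es : s = s * (p ^+ 2 - b * p * q + q ^+ 2) by rewrite E mulr1.
by rewrite [X in _ + X = _]Es; ring.
Qed.

Lemma lucas_sub_2l b k i :
  lucas b (k + i.*2) - lucas b k =
  (2 * lucas b (k + i).+1 - b * lucas b (k + i)) * lucas b i.
Proof.
rewrite -addnn !(lucas_add _ k) !(lucas_add _ i) !lucas_addS.
have := lucas_quad b i; set p := lucas b i.+1; set q := lucas b i.
set r := lucas b k.+1; set s := lucas b k => E.
have Es : s = s * (p ^+ 2 - b * p * q + q ^+ 2) by rewrite E mulr1.
by rewrite [X in _ - X = _]Es; ring.
Qed.

(** Modulo V_l the shift of the index by 2l changes the sign of the term, and the reflection of n to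
    2l - n preserves it. So every index folds into the interval from 0 to l, and modulo l it changes
    at most by a sign. *)
Lemma lucas_fold b l n : (0 < l)%N -> exists k, [/\ (k <= l)%N,
   (2 * lucas b l.+1 - b * lucas b l %| lucas b n - lucas b k)%Z \/
   (2 * lucas b l.+1 - b * lucas b l %| lucas b n + lucas b k)%Z &
   (l%:Z %| n%:Z - k%:Z)%Z \/ (l%:Z %| n%:Z + k%:Z)%Z].
Proof.
move=> l0; set v := 2 * _ - _; elim/ltn_ind: n => n IH.
case: (leqP n l) => [nl|ln].
  by exists n; split=> //; left; rewrite subrr dvdz0.
case: (leqP n l.*2) => [nl|ln2].
  exists (l.*2 - n)%N; split; first by lia.
    left; have {1}-> : n = ((l.*2 - n) + (n - l).*2)%N by lia.
    rewrite lucas_sub_2l (_ : l.*2 - n + (n - l) = l)%N; last by lia.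
    by rewrite dvdz_mulr.
  by right; rewrite (_ : _ + _ = 2 * l%:Z) ?dvdz_mull //; lia.
have nE : n = (n - l.*2 + l.*2)%N by lia.
have [|k [kl Hv Hl]] := IH (n - l.*2)%N; first by lia.
exists k; split=> //.
  have Hn : (v %| lucas b n + lucas b (n - l.*2))%Z by rewrite {1}nE lucas_add_2l dvdz_mulr.
  case: Hv => Hv; [right|left].
    have -> : lucas b n + lucas b k = lucas b n + lucas b (n - l.*2) - (lucas b (n - l.*2) - lucas b k) by ring.
    by rewrite rpredB.
  have -> : lucas b n - lucas b k = lucas b n + lucas b (n - l.*2) - (lucas b (n - l.*2) + lucas b k) by ring.
  by rewrite rpredB.
have En : n%:Z = (n - l.*2)%N%:Z + 2 * l%:Z by lia.
case: Hl => Hl; [left|right]; rewrite En addrAC; apply: rpredD => //; exact: dvdz_mull.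
Qed.

Lemma small_dvdz_eq0 d e : (d %| e)%Z -> - d < e -> e < d -> e = 0.
Proof.
move=> /dvdzP[q ->] h1 h2.
have : q < 1 by nia.
have : -1 < q by nia.
move=> h3 h4; have -> : q = 0 by lia.
by rewrite mul0r.
Qed.

End LucasSequence.

(** * A Diophantine definition of alpha_b(k) *)

Lemma congn_dvdz (m a b : nat) : congn m a b <-> (m%:Z %| (a%:Z - b%:Z)%R)%Z.
Proof.
split=> [[u [v H]]|/dvdzP[[q|q] E]].
- by apply/dvdzP; exists (v%:Z - u%:Z)%R; rewrite mulrBl; lia.
- by exists 0, q; lia.
- by exists q.+1, 0; move: E; rewrite NegzE mulNr; lia.
Qed.

Definition alpha (b n : nat) : nat := absz (lucas b%:Z n).

Lemma alphaE b n : 2 <= b -> Posz (alpha b n) = lucas (Posz b) n.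
Proof. by move=> b2; rewrite /alpha gez0_abs // lucas_ge0; lia. Qed.

Lemma alpha_geid b n : 2 <= b -> n <= alpha b n.
Proof. by move=> b2; have := @lucas_geid (Posz b) n; rewrite -alphaE //; lia. Qed.

Lemma alpha_quad b n : 2 <= b ->
  alpha b n.+1 * alpha b n.+1 + alpha b n * alpha b n = b * alpha b n.+1 * alpha b n + 1.
Proof. by move=> b2; have := lucas_quad (Posz b) n; rewrite -!alphaE //; lia. Qed.

Lemma alpha_lt b m n : 2 <= b -> m < n -> alpha b m < alpha b n.
Proof. by move=> b2 /(@lucas_lt (Posz b)); rewrite -!alphaE //; lia. Qed.

Lemma alpha_odd_large b N : 2 <= b -> exists2 m, N < m & odd (alpha b m).
Proof.
move=> b2; have := alpha_quad N.+1 b2 => /(congr1 odd).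
rewrite !oddD !oddM /=; case E1: (odd (alpha b N.+2)); first by exists N.+2.
by case E2: (odd (alpha b N.+1)); [exists N.+1|rewrite /= andbF].
Qed.

(** Intended values: u = alpha_b(m); s = alpha_b(l) and r = alpha_b(l-1) with u^2 dividing s, hence
    u dividing l; v = V_l; x = alpha_w(n). As w is b modulo v and 2 modulo u, x is alpha_b(n) modulo
    v and n modulo u, so a is alpha_b(n) modulo v and k is n modulo u. *)
Definition alpha_system (b k a u t s r v w x y : nat) : Prop :=
  u * u + t * t = b * u * t + 1 /\ s * s + r * r = b * s * r + 1 /\ r < s /\
  u * u %| s /\ v + 2 * r = b * s /\ congn v w b /\ congn u w 2 /\ 2 < w /\
  x * x + y * y = w * x * y + 1 /\ congn v x a /\ congn u x k /\
  2 * a < u /\ 2 * a < v /\ 2 * k < u.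

Lemma alpha_system_sound b k a u t s r v w x y : 4 <= b ->
  alpha_system b k a u t s r v w x y -> a = alpha b k.
Proof.
move=> b4 [Eu [Es [rs [us [Ev [wb [w2 [w2' [Ex [xa [xk [au [av ku]]]]]]]]]]]]].
have b2 : (2 <= (Posz b))%R by lia.
have [m Um] : exists m, (Posz u) = lucas b m by apply: (lucas_complete (t := t) b2); lia.
have [l' [Sl Rl]] : exists l', (Posz s) = lucas b l'.+1 /\ (Posz r) = lucas b l'.
  by apply: lucas_complete_le => //; lia.
have [n Xn] : exists n, (Posz x) = lucas w n by apply: (lucas_complete (t := y)); lia.
have m0 : 0 < m by case: m Um => // Um; move: au; rewrite lucas0 in Um; lia.
have ul : ((Posz u) %| (Posz l'.+1))%Z.
  rewrite Um; apply: lucas_sqr_dvd => //; rewrite -Um -Sl.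
  by rewrite expr2 -PoszM.
have vE : (Posz v) = (2 * lucas b l'.+2 - (Posz b) * lucas b l'.+1)%R by rewrite lucasSS -Sl -Rl; lia.
move/congn_dvdz in wb; move/congn_dvdz in w2; move/congn_dvdz in xa; move/congn_dvdz in xk.
have va : ((Posz v) %| (lucas b n - (Posz a))%R)%Z.
  have := lucas_congr (Posz w) (Posz b) n; rewrite -Xn => /(dvdz_trans wb) H.
  have -> : (lucas b n - (Posz a) = ((Posz x) - (Posz a)) - ((Posz x) - lucas b n))%R by ring.
  exact: rpredB.
have nk : ((Posz u) %| ((Posz n) - (Posz k))%R)%Z.
  have := lucas_congr (Posz w) (Posz 2) n; rewrite lucas_two -Xn => /(dvdz_trans w2) H.
  have -> : ((Posz n) - (Posz k) = ((Posz x) - (Posz k)) - ((Posz x) - (Posz n)))%R by ring.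
  exact: rpredB.
(* Fold n to an index k' at most l. Then alpha_b(k') is at most s < v/2 and a < v/2, so their
   congruence up to sign modulo v yields an equality. *)
have [k' [kl Hv Hl]] := lucas_fold (Posz b) n (ltn0Sn l').
rewrite -vE in Hv.
have k'0 := @lucas_ge0 (Posz b) k' b2.
have k's := lucas_leq b2 kl; rewrite -Sl in k's.
have sv : 2 * s < v by clear -Ev rs b4; nia.
clear Eu Es us Ev Ex Um Xn vE.
have Ea : lucas b k' = Posz a.
  case: Hv => Hv.
    have := small_dvdz_eq0 (rpredB va Hv); clear -k'0 k's sv av => H.
    by have := H ltac:(lia) ltac:(lia); lia.
  have := small_dvdz_eq0 (rpredB Hv va); clear -k'0 k's sv av => H.
  by have := H ltac:(lia) ltac:(lia); lia.
(* So 2k' < u as well as 2k < u, and k congruent to k' up to sign modulo u gives k = k'. *)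
have k'a : (Posz k' <= Posz a)%R by rewrite -Ea lucas_geid.
suff -> : k = k' by rewrite /alpha Ea.
case: Hl => /(dvdz_trans ul) H'.
  have := small_dvdz_eq0 (rpredB H' nk); clear -k'a au ku => H.
  by have := H ltac:(lia) ltac:(lia); lia.
have := small_dvdz_eq0 (rpredB H' nk); clear -k'a au ku => H.
by have := H ltac:(lia) ltac:(lia); lia.
Qed.

Lemma alpha_system_complete b k : 4 <= b ->
  exists u t s r v w x y, alpha_system b k (alpha b k) u t s r v w x y.
Proof.
move=> b4; have b2 : 2 <= b by lia.
set a := alpha b k.
(* An odd u keeps the prime 2 out of gcd(u, v); a large m gives the size conditions. *)
have [m mN oddm] := alpha_odd_large (2 * (a + k)).+1 b2.
pose u := alpha b m; pose t := alpha b m.+1.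
have um : m <= u by apply: alpha_geid.
(* The index mu for s makes u^2 divide s, by [lucas_sqr_dvd_mul]. *)
have [l' lE] : exists l', m * u = l'.+1.
  have : 0 < m * u by rewrite muln_gt0; lia.
  by case: (m * u) => // l' _; exists l'.
pose s := alpha b l'.+1; pose r := alpha b l'.
have rs : r < s by apply: alpha_lt.
have sl : l'.+1 <= s by apply: alpha_geid.
have rb : 2 * r <= b * s by clear -rs b4; nia.
pose v := b * s - 2 * r.
have us : u * u %| s.
  have := @lucas_sqr_dvd_mul b m u; rewrite lE -!alphaE // => /(_ (dvdzz _)).
  by rewrite expr2 -PoszM.
have quad_s : s * s + r * r = b * s * r + 1 by apply: alpha_quad.
(* A common prime p divides s and hence 2r; it is odd as u is, so it divides r, contradicting s^2 +
   r^2 = bsr + 1. *)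
have cuv : coprime u v.
  apply: contraT => ncop.
  have g1 : 1 < gcdn u v.
    have : 0 < gcdn u v by rewrite gcdn_gt0; clear -um mN; lia.
    by move: ncop; rewrite /coprime; case: (gcdn u v) => [|[|]].
  have pp := pdiv_prime g1; set p := pdiv _ in pp.
  have pu : p %| u by apply: dvdn_trans (pdiv_dvd _) (dvdn_gcdl _ _).
  have pv : p %| v by apply: dvdn_trans (pdiv_dvd _) (dvdn_gcdr _ _).
  have ps : p %| s by apply: dvdn_trans us; apply: dvdn_mulr.
  have p2r : p %| 2 * r.
    by rewrite -(dvdn_addr _ pv) /v subnK // dvdn_mull.
  have pr : p %| r.
    move: p2r; rewrite Euclid_dvdM // => /orP[|//].
    rewrite dvdn_prime2 // => /eqP p2; move: pu.
    by rewrite p2 dvdn2 oddm.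
  have : p %| b * s * r + 1 by rewrite -quad_s dvdn_add // dvdn_mull.
  rewrite dvdn_addr; last by rewrite -mulnA dvdn_mull // dvdn_mull.
  by rewrite dvdn1 => /eqP p1; rewrite p1 in pp.
have uv0 : 0 < u * v.
  by rewrite muln_gt0 /v; clear -um mN rs b4; apply/andP; split; nia.
(* The added multiple of uv ensures w > 2. *)
pose w := chinese u v 2 b + 3 * (u * v).
have wu : congn u w 2.
  by rewrite congnP /w mulnA mulnAC addnC modnMDl chinese_modl.
have wv : congn v w b.
  by rewrite congnP /w mulnA addnC modnMDl chinese_modr.
have w2 : 2 < w by clear -uv0; lia.
exists u, t, s, r, v, w, (alpha w k), (alpha w k.+1).
have w2' : 2 <= w by lia.
have quad_u := alpha_quad m b2; have quad_w := alpha_quad k w2'.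
do !split=> //.
- by clear -quad_u; lia.
- by rewrite /v subnK.
- by clear -quad_w; lia.
- move/congn_dvdz in wv; rewrite congn_dvdz /a !alphaE //.
  exact: dvdz_trans wv (lucas_congr _ _ _).
- move/congn_dvdz in wu; rewrite congn_dvdz !alphaE // -(lucas_two k).
  exact: dvdz_trans wu (lucas_congr _ _ _).
- by clear -mN um; lia.
- have : m <= s by apply: leq_trans sl; rewrite -lE; clear -um mN; nia.
  by rewrite /v; clear -rs b4 mN; nia.
- by clear -mN um; lia.
Qed.

Lemma ndio_alpha h f g : nfun h -> nfun f -> nfun g -> (forall nu, 4 <= h nu) ->
  ndio (fun nu => g nu = alpha (h nu) (f nu)).
Proof.
move=> Hh Hf Hg h4.
apply: (@dio_iff _ _ _ _ (fun nu => exists u t s r v w x y,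
   alpha_system (h nu) (f nu) (g nu) u t s r v w x y)); last first.
  move=> nu; split=> [|->]; last exact: alpha_system_complete.
  by move=> [u [t [s [r [v [w [x [y]]]]]]]]; apply: alpha_system_sound.
rewrite /alpha_system.
by ndio_tac.
Qed.

Lemma nfun_alpha h f : nfun h -> nfun f -> (forall nu, 4 <= h nu) ->
  nfun (fun nu => alpha (h nu) (f nu)).
Proof. by move=> Hh Hf h4; apply: ndio_alpha => //; nfun_tac. Qed.

(** * Exponentiation *)

Lemma exprn_lucas (b q : int) n : exists e,
  (q ^+ n = lucas b n.+1 - (b - q) * lucas b n + (b * q - q ^+ 2 - 1) * e)%R.
Proof.
elim: n => [|n [e IH]]; first by exists 0%R; rewrite lucas0 lucas1; ring.
by exists (q * e - lucas b n)%R; rewrite exprS IH lucasSS; ring.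
Qed.

Lemma alpha_expn_le b n : 1 < b -> b.-1 ^ n <= alpha b n.+1.
Proof.
move=> b2; elim: n => [|n IH]; first by rewrite expn0 (leq_trans _ (@alpha_geid b 1 _)).
have := lucasSS b%:Z n; rewrite -!alphaE // => E.
have := alpha_lt b2 (ltnSn n); rewrite expnS => H.
apply: leq_trans (leq_mul (leqnn _) IH) _; clear -E H b2; nia.
Qed.

(** The parameter b must be exponentially large yet Diophantine, so it is itself built from an
    alpha: alpha_(q+5)(n+1) is at least (q+4)^n. The other summands make b(q+1) - (q+1)^2 - 1 exceed
    (q+1)^n. *)
Definition pow_param q n := alpha (q + 5) n.+1 + q.+1 * q.+1 + 2.

Lemma pow_param_ge4 q n : 4 <= pow_param q n.
Proof. by rewrite /pow_param; have := @alpha_geid (q + 5) n.+1; lia. Qed.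

Lemma nfun_pow_param f g : nfun f -> nfun g -> nfun (fun nu => pow_param (f nu) (g nu)).
Proof.
move=> Hf Hg; rewrite /pow_param; nfun_tac.
by apply: nfun_alpha => [||nu]; [nfun_tac|nfun_tac|lia].
Qed.

(** Modulo m = b(q+1) - (q+1)^2 - 1 the base q+1 is a root of X^2 - bX + 1, so [exprn_lucas] gives
    its n-th power modulo m. As both p and the power are below m, the congruence determines p; c = b
    - (q+1) avoids subtraction. *)
Lemma expn_alpha q n p : p = q.+1 ^ n <->
  exists m c, m + q.+1 * q.+1 + 1 = pow_param q n * q.+1 /\ c + q.+1 = pow_param q n /\ p < m /\
    congn m (p + c * alpha (pow_param q n) n) (alpha (pow_param q n) n.+1).
Proof.
set b := pow_param q n.
have a1 : q.+1 ^ n <= alpha (q + 5) n.+1.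
  apply: leq_trans (alpha_expn_le _ _); last by lia.
  by case: (n) => [|n'] //; rewrite leq_exp2r //; lia.
have b2 : 2 <= b by apply: leq_trans (pow_param_ge4 _ _).
have bE : b = alpha (q + 5) n.+1 + q.+1 * q.+1 + 2 by [].
clearbody b.
have mlarge m : m + q.+1 * q.+1 + 1 = b * q.+1 -> q.+1 ^ n < m.
  by clear b2; subst b; move=> E; nia.
have pow_cong m c : m + q.+1 * q.+1 + 1 = b * q.+1 -> c + q.+1 = b ->
    congn m (q.+1 ^ n + c * alpha b n) (alpha b n.+1).
  move=> Em Ec; apply/congn_dvdz; have [e E] := exprn_lucas b q.+1%:Z n.
  apply/dvdzP; exists e.
  rewrite PoszD PoszM -!alphaE // in E *.
  have -> : Posz (q.+1 ^ n) = (Posz q.+1 ^+ n)%R by elim: (n) => // k IHk; rewrite expnS exprS PoszM IHk.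
  rewrite E (_ : Posz b = Posz c + Posz q.+1)%R; last by lia.
  rewrite (_ : Posz m = Posz b * Posz q.+1 - Posz q.+1 ^+ 2 - 1)%R; last by lia.
  rewrite (_ : Posz b = Posz c + Posz q.+1)%R; last by lia.
  ring.
split=> [->|[m [c [Em [Ec [pm Hp]]]]]].
  have qb : q.+1 <= b by lia.
  exists (b * q.+1 - q.+1 * q.+1 - 1), (b - q.+1).
  have Em : b * q.+1 - q.+1 * q.+1 - 1 + q.+1 * q.+1 + 1 = b * q.+1.
    by clear -qb bE; subst b; nia.
  by split=> //; split; [lia|split; [apply: mlarge|apply: pow_cong => //; lia]].
have Hq := pow_cong _ _ Em Ec; have qm := mlarge _ Em.
rewrite !congnP in Hp Hq.
have := etrans Hp (esym Hq) => /eqP; rewrite eqn_modDr !modn_small //.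
by move/eqP.
Qed.

Ltac nfun_ext ::= match goal with
 | |- dfun _ _ _ (fun nu => pow_param (@?f nu) (@?g nu)) =>
     refine (nfun_pow_param (f := f) (g := g) _ _)
 | |- dfun _ _ _ (fun nu => alpha (pow_param (@?f nu) (@?g nu)) (@?h nu)) =>
     refine (nfun_alpha (h := fun nu => pow_param (f nu) (g nu)) (f := h) _ _
       (fun nu => pow_param_ge4 _ _))
 end.

Lemma nfun_expn f g : nfun f -> nfun g -> nfun (fun nu => (f nu).+1 ^ g nu).
Proof.
move=> Hf Hg; rewrite /dfun.
apply: (dio_iff _ (fun nu => iff_sym (expn_alpha _ _ _))).
by ndio_tac.
Qed.

(** * Binomial coefficients and factorials *)

Lemma digit_sum B m (s : nat -> nat) k : (forall i, s i < B) ->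
  ((\sum_(i < m) s i * B ^ i) %/ B ^ k) %% B = if k < m then s k else 0.
Proof.
move=> sB; have B0 : 0 < B by have := sB 0; lia.
elim: m s sB k => [|m IH] s sB k; first by rewrite big_ord0 div0n mod0n.
rewrite big_ord_recl expn0 muln1.
have -> : \sum_(i < m) s (lift ord0 i) * B ^ lift ord0 i = (\sum_(i < m) s i.+1 * B ^ i) * B.
  by rewrite big_distrl; apply: eq_bigr => i _; rewrite lift0 expnSr mulnA.
case: k => [|k]; first by rewrite divn1 addnC modnMDl modn_small.
rewrite expnS divnMA addnC divnMDl // [s _ %/ B]divn_small // addn0.
exact: (IH (fun i => s i.+1)).
Qed.

Lemma bin_leq_exp n k : 'C(n, k) <= 2 ^ n.
Proof.
elim: n k => [|n IH] [|k] //; first by rewrite bin0 expn_gt0.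
by rewrite binS expnS mul2n -addnn leq_add.
Qed.

(** The base 2^n + 1 exceeds every coefficient, so the expansion of (1 + base)^n has no carries. *)
Lemma bin_digit n k : 'C(n, k) = ((2 ^ n).+2 ^ n %/ (2 ^ n).+1 ^ k) %% (2 ^ n).+1.
Proof.
rewrite -[in (2 ^ n).+2]add1n expnDn.
have -> : \sum_(i < n.+1) 'C(n, i) * (1 ^ (n - i) * (2 ^ n).+1 ^ i) =
          \sum_(i < n.+1) 'C(n, i) * (2 ^ n).+1 ^ i.
  by apply: eq_bigr => i _; rewrite exp1n mul1n.
rewrite (@digit_sum _ _ (fun i => 'C(n, i))) => [|i]; last by rewrite ltnS bin_leq_exp.
by case: ltnP => // /bin_small.
Qed.

Lemma nfun_bin f g : nfun f -> nfun g -> nfun (fun nu => 'C(f nu, g nu)).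
Proof.
move=> Hf Hg.
have H2 : nfun (fun nu => 2 ^ f nu) by apply: (nfun_expn (f := fun=> 1)); nfun_tac.
apply: (@dio_iff _ _ _ _ (fun nu => nu 0 = ((2 ^ f (fun i => nu i.+1)).+2 ^ f (fun i => nu i.+1) %/
   (2 ^ f (fun i => nu i.+1)).+1 ^ g (fun i => nu i.+1)) %% (2 ^ f (fun i => nu i.+1)).+1)); last first.
  by move=> nu; rewrite bin_digit.
apply: (nfun_modn (f := fun nu => (2 ^ f nu).+2 ^ f nu %/ (2 ^ f nu).+1 ^ g nu)
  (g := fun nu => (2 ^ f nu).+1)) => [||//]; last by apply: nfun_succ.
apply: nfun_divn => [||nu]; last by rewrite expn_gt0.
- by apply: (nfun_expn (f := fun nu => (2 ^ f nu).+1)) => //; apply: nfun_succ.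
- by apply: (nfun_expn (f := fun nu => 2 ^ f nu)).
Qed.

(** Each of the w+1 factors of the falling factorial falls short of r by at most w. *)
Lemma expn_ffact_le r w : r ^ w.+1 <= r ^_ w.+1 + w.+1 * w.+1 * r ^ w.
Proof.
elim: w => [|w IH]; first by rewrite ffactn1 expn1 leq_addr.
rewrite expnS ffactnSr; move: IH; rewrite [r ^ w.+1]expnS => IH.
have : r ^_ w.+1 <= r * r ^ w.
  by rewrite -expnS; elim: (w.+1) => // k IHk; rewrite ffactnSr expnSr leq_mul ?leq_subr.
set F := r ^_ w.+1 in IH *; set E := r ^ w in IH *.
have H2 : r <= (r - w.+1) + w.+1 by lia.
move=> H3.
have H4 : r * F <= F * (r - w.+1) + w.+1 * F by nia.
have H5 : r * (r * E) <= r * F + r * (w.+1 * w.+1 * E) by rewrite -mulnDr leq_mul2l IH orbT.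
have H6 : w.+1 * F <= w.+1 * (r * E) by rewrite leq_mul2l H3 orbT.
rewrite (_ : r * (w.+1 * w.+1 * E) = w.+1 * w.+1 * (r * E)) in H5; last by ring.
have : w.+2 * w.+2 * (r * E) = w.+1 * w.+1 * (r * E) + w.+1 * (r * E) + w.+2 * (r * E) by ring.
by move: (r * E) => z in H5 H6 *; lia.
Qed.

(** It exceeds (w! + 1) w^2, with w! bounded by (w+1)^w so that the formula is Diophantine before
    factorials are. This size keeps r^w - w! C(r,w) below C(r,w) in [fact_divn]. *)
Definition fact_base w := ((w.+1 ^ w + 1) * (w * w)).+1.

Lemma fact_leq_exp w : w`! <= w.+1 ^ w.
Proof.
elim: w => // w IH; rewrite factS expnS leq_mul //.
apply: leq_trans IH _; by case: (w) => // v; rewrite leq_exp2r.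
Qed.

Lemma fact_base_ge w : w <= fact_base w.
Proof. by rewrite /fact_base; case: w => // w; rewrite mulnDl mul1n; nia. Qed.

Lemma fact_divn w : w`! = fact_base w ^ w %/ 'C(fact_base w, w).
Proof.
case: w => [|w]; first by rewrite expn0 bin0.
set r := fact_base _.
have C0 : 0 < 'C(r, w.+1) by rewrite bin_gt0 fact_base_ge.
have Cf : 'C(r, w.+1) * w.+1`! = r ^_ w.+1 := bin_ffact _ _.
have H1 : r ^_ w.+1 <= r ^ w.+1.
  by elim: (w.+1) => // k IHk; rewrite ffactnSr expnSr leq_mul ?leq_subr.
have H2 := expn_ffact_le r w.
have fr : (w.+1`! + 1) * (w.+1 * w.+1) < r.
  by rewrite ltnS leq_mul2r leq_add2r fact_leq_exp orbT.
suff H3 : w.+1 * w.+1 * r ^ w < 'C(r, w.+1).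
  have -> : r ^ w.+1 = w.+1`! * 'C(r, w.+1) + (r ^ w.+1 - r ^_ w.+1).
    by rewrite mulnC Cf subnKC.
  by rewrite divnMDl // divn_small ?addn0 //; lia.
rewrite -(ltn_pmul2r (fact_gt0 w.+1)) Cf.
have r0 : 0 < r ^ w by rewrite expn_gt0.
move: fr H2; rewrite expnS; move: (r ^ w) r0 => E r0 fr H2.
have : ((w.+1)`! + 1) * (w.+1 * w.+1) * E < r * E by rewrite ltn_pmul2r.
rewrite mulnDl mul1n mulnDl (mulnC _`!) mulnAC.
by lia.
Qed.

Lemma nfun_fact f : nfun f -> nfun (fun nu => (f nu)`!).
Proof.
apply: (dfun_op1 (h := factorial)).
have Hr : nfun (fun nu => fact_base (nu 0)).
  rewrite /fact_base; nfun_tac.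
  by apply: (nfun_expn (f := fun nu => nu 0)); nfun_tac.
apply: (@dio_iff _ _ _ _ (fun nu => nu 0 = fact_base (nu 1) ^ (nu 1) %/ 'C(fact_base (nu 1), nu 1))); last first.
  by move=> nu; rewrite fact_divn.
apply: (nfun_divn (f := fun nu => fact_base (nu 0) ^ nu 0) (g := fun nu => 'C(fact_base (nu 0), nu 0)))
  => [||nu].
- apply: (nfun_expn (f := fun nu => ((nu 0).+1 ^ nu 0 + 1) * (nu 0 * nu 0))); nfun_tac.
  by apply: (nfun_expn (f := fun nu => nu 0)); nfun_tac.
- by apply: nfun_bin => //; nfun_tac.
- by rewrite bin_gt0 fact_base_ge.
Qed.

(** * Bounded universal quantification *)

Lemma coprime_prod_ord n (M : nat -> nat) d :
  (forall k, k < n -> coprime (M k) d) -> coprime (\prod_(k < n) M k) d.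
Proof.
elim: n => [|n IH] H; first by rewrite big_ord0 coprime1n.
rewrite big_ord_recr coprimeMl IH /= ?H // => k kn.
by apply: H; apply: ltnW.
Qed.

Definition pairwise_coprime n (M : nat -> nat) :=
  forall j k, j < k -> k < n -> coprime (M j) (M k).

Lemma prod_dvd n (M : nat -> nat) d : pairwise_coprime n M ->
  (forall k, k < n -> M k %| d) -> \prod_(k < n) M k %| d.
Proof.
elim: n => [|n IH] cM H; first by rewrite big_ord0 dvd1n.
rewrite big_ord_recr Gauss_dvd /=; last first.
  by apply: coprime_prod_ord => k kn; apply: cM.
rewrite H // andbT IH // => [j k jk kn|k kn]; first by apply: cM => //; apply: ltnW.
by apply: H; apply: ltnW.
Qed.

Lemma chinese_seq n (M x : nat -> nat) : pairwise_coprime n M ->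
  exists a, forall k, k < n -> a = x k %[mod M k].
Proof.
elim: n => [|n IH] cM; first by exists 0.
have [|a Ha] := IH; first by move=> j k jk kn; apply: cM => //; apply: ltnW.
have cop : coprime (\prod_(k < n) M k) (M n).
  by apply: coprime_prod_ord => k kn; apply: cM.
exists (chinese (\prod_(k < n) M k) (M n) a (x n)) => k.
rewrite ltnS leq_eqVlt => /predU1P[->|kn]; first by rewrite chinese_modr.
rewrite -Ha //; have := chinese_modl cop a (x n) => H.
have Mk : M k %| \prod_(k < n) M k by rewrite (bigD1 (Ordinal kn)) //= dvdn_mulr.
by rewrite -(modn_dvdm _ Mk) H modn_dvdm.
Qed.

Lemma eqmod_prod n (M : nat -> nat) x y : pairwise_coprime n M ->
  (forall k, k < n -> x = y %[mod M k]) -> x = y %[mod \prod_(k < n) M k].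
Proof.
move=> cM; wlog xy : x y / x <= y => [W H|H].
  by case: (leqP x y) => [/W|/ltnW/W]; [apply|move=> V; apply/esym/V => k kn; apply/esym/H].
apply/esym/eqP; rewrite eqn_mod_dvd //; apply: prod_dvd => // k kn.
by rewrite -eqn_mod_dvd // H.
Qed.

(** The moduli [L / (k+1) - 1] with [L = w!^2]: their product is the single
    binomial coefficient ['C(L - 1, n)], and [L - 1] is congruent to [k] modulo
    the [k]-th one for all [k] at once. *)
Section Moduli.
Variable w : nat.
Let L := w`! * w`!.
Definition modulus k := L %/ k.+1 - 1.

Let divL k : k < w -> L %/ k.+1 = w`! * (w`! %/ k.+1).
Proof. by move=> kw; rewrite muln_divA // dvdn_fact. Qed.

Let divL_gt0 k : k < w -> 0 < w`! %/ k.+1.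
Proof. by move=> kw; rewrite divn_gt0 // dvdn_leq ?fact_gt0 // dvdn_fact. Qed.

Lemma modulusE k : k < w -> L.-1 = k.+1 * modulus k + k.
Proof.
move=> kw; have LE : L = k.+1 * (L %/ k.+1).
  by rewrite mulnC divnK // dvdn_mulr // dvdn_fact.
have : 0 < L %/ k.+1 by rewrite divL // muln_gt0 fact_gt0 divL_gt0.
rewrite /modulus; move: (L %/ k.+1) LE => d -> d0.
by rewrite -{1}(subnK d0); lia.
Qed.

Lemma modulus_eqmod d k : k < w -> d %| modulus k -> L.-1 = k %[mod d].
Proof. by move=> kw /dvdnP[c E]; rewrite (modulusE kw) E mulnA modnMDl. Qed.

Lemma modulus_gt1 k : 2 < w -> k < w -> 1 < modulus k.
Proof.
move=> w2 kw; rewrite /modulus divL //.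
have := leq_pmulr w`! (divL_gt0 kw); have := fact_geq w.
by lia.
Qed.

Lemma modulus_prime p k : k < w -> prime p -> p %| modulus k -> w < p.
Proof.
move=> kw pp pM; rewrite ltnNge; apply/negP => pw.
have pL : p %| L %/ k.+1 by rewrite divL // dvdn_mulr // dvdn_fact // prime_gt0.
have L1 : 0 < L %/ k.+1 by rewrite divL // muln_gt0 fact_gt0 divL_gt0.
have : p %| 1 by rewrite -(subKn L1) dvdn_sub.
by rewrite dvdn1 => /eqP p1; rewrite p1 in pp.
Qed.

(** A common prime of the moduli j and k exceeds w, while L - 1 is congruent to both j and k modulo
    it; these are below w, hence equal. *)
Lemma modulus_coprime n : n <= w -> pairwise_coprime n modulus.
Proof.
move=> nw j k jk kn; apply: contraT => ncop.
have kw : k < w by apply: leq_trans nw.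
have jw : j < w by apply: ltn_trans kw.
have [p pp pg] : exists2 p, prime p & p %| gcdn (modulus j) (modulus k).
  move: ncop; rewrite /coprime; case: (gcdn _ _) => [|[|g]] // _; first by exists 2.
  by exists (pdiv g.+2); rewrite ?pdiv_prime ?pdiv_dvd.
have pj := dvdn_trans pg (dvdn_gcdl _ _); have pk := dvdn_trans pg (dvdn_gcdr _ _).
have wp := modulus_prime jw pp pj.
have := etrans (esym (modulus_eqmod jw pj)) (modulus_eqmod kw pk).
by rewrite !modn_small; lia.
Qed.

(** Since (k+1) times the k-th modulus is L - 1 - k, the product times n! is the falling factorial
    of L - 1. *)
Lemma prod_modulus n : n <= w -> \prod_(k < n) modulus k = 'C(L.-1, n).
Proof.
elim: n => [|n IH] nw; first by rewrite big_ord0 bin0.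
rewrite big_ord_recr /= IH 1?ltnW //; apply/eqP.
rewrite -(eqn_pmul2l (ltn0Sn n)) mul_bin_left.
by rewrite {2}(modulusE nw) addnK mulnCA mulnC.
Qed.

End Moduli.

(** The prime divides some factor a - j with j < q. A single divisibility by the product of the
    moduli thus bounds residues for all k at once. *)
Lemma bin_dvd_mod_lt p a q : prime p -> p %| 'C(a, q) -> a %% p < q.
Proof.
move=> pp pC; have : p %| a ^_ q by rewrite -bin_ffact dvdn_mulr.
elim: q {pC} => [|q IH]; first by rewrite ffactn0 dvdn1 => /eqP p1; rewrite p1 in pp.
rewrite ffactnSr Euclid_dvdM // => /orP[/IH|]; first exact: ltnW.
case: (leqP a q) => [aq _|qa]; first by rewrite ltnS (leq_trans (leq_mod _ _)).
rewrite -eqn_mod_dvd; last exact: ltnW.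
by move=> /eqP->; rewrite ltnS leq_mod.
Qed.

Lemma dvd_bin_of_eqmod m a x q : x < q -> coprime m q`! -> a = x %[mod m] -> m %| 'C(a, q).
Proof.
move=> xq cop E; case: (ltnP a q) => [aq|qa]; first by rewrite bin_small.
rewrite -(Gauss_dvdl _ cop) bin_ffact.
have xa : x <= a by lia.
have : m %| a - x by rewrite -eqn_mod_dvd //; apply/eqP.
elim: q xq {cop qa} => // q IH; rewrite ltnS leq_eqVlt ffactnSr => /predU1P[<- H|xq H].
  exact: dvdn_mull.
by rewrite dvdn_mulr // IH.
Qed.

Lemma coprime_fact_of_primes m q : (forall p, prime p -> p %| m -> q < p) -> coprime m q`!.
Proof.
move=> H; rewrite coprime_sym; elim: q H => [|q IH] H; first by rewrite coprime1n.
rewrite factS coprimeMl IH ?andbT; last by move=> p pp pm; apply: ltnW; apply: H.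
apply: contraT => ncop.
have : 0 < gcdn q.+1 m by rewrite gcdn_gt0.
move: ncop; rewrite /coprime; case E: (gcdn _ _) => [|[|g]] // _ _.
have pp : prime (pdiv g.+2) by apply: pdiv_prime.
have := H _ pp; have := pdiv_dvd g.+2; rewrite -{2}E dvdn_gcd => /andP[p1 ->] /(_ isT).
by have := dvdn_leq (ltn0Sn q) p1; lia.
Qed.

Lemma fin_choice (A : Type) (a0 : A) n (R : nat -> A -> Prop) :
  (forall i, i < n -> exists x, R i x) -> exists f, forall i, i < n -> R i (f i).
Proof.
elim: n => [|n IH] H; first by exists (fun=> a0).
have [|f Hf] := IH; first by move=> i lin; apply: H; apply: ltnW.
have [x Hx] := H n (ltnSn n); exists (fun i => if i == n then x else f i) => i.
by rewrite ltnS leq_eqVlt; case: eqP => [->|_ /= /Hf].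
Qed.

Lemma fin_bound n (f : nat -> nat) : exists q, forall i, i < n -> f i < q.
Proof.
elim: n => [|n [q Hq]]; first by exists 0.
exists (q + (f n).+1) => i; rewrite ltnS leq_eqVlt => /predU1P[->|/Hq]; lia.
Qed.

Lemma fin_bound2 m n (f : nat -> nat -> nat) :
  exists q, forall i j, i < m -> j < n -> f i j < q.
Proof.
elim: m => [|m [q Hq]]; first by exists 0.
have [r Hr] := fin_bound n (f m).
exists (q + r) => i j; rewrite ltnS leq_eqVlt => /predU1P[->|im] jn.
  by have := Hr _ jn; lia.
by have := Hq _ _ im jn; lia.
Qed.

Definition constr_lt N (c : constr) : bool :=
  match c with
  | EOne i => i < N
  | EAdd i j k | EMul i j k => [&& i < N, j < N & k < N]
  end.

Lemma constr_bound l : exists N, all (constr_lt N) l.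
Proof.
have mono N N' c : N <= N' -> constr_lt N c -> constr_lt N' c.
  by move=> NN'; case: c => [i|i j k|i j k] /=; lia.
elim: l => [|c l [N HN]]; first by exists 0.
have [N' Hc] : exists N', constr_lt N' c.
  by case: c => [i|i j k|i j k]; [exists i.+1|exists (i + j + k).+1|exists (i + j + k).+1] => /=; lia.
exists (N + N') => /=; rewrite (mono _ _ _ _ Hc) ?leq_addl //=.
by apply: sub_all HN => c'; apply: mono; apply: leq_addr.
Qed.

Lemma sat_eq_lt (D : Type) (one : D) (add mul : D -> D -> D) N (u v : nat -> D) l :
  all (constr_lt N) l -> (forall i, i < N -> u i = v i) ->
  sat one add mul u l -> sat one add mul v l.
Proof.
move=> + E; elim: l => //= c l IH /andP[Hc /IH Hl] [H /Hl{}Hl]; split=> //.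
by case: c Hc H => [i|i j k|i j k] /=; [move=> /E->|move=> /and3P[/E-> /E-> /E->]..].
Qed.

Definition scons (k : nat) (nu : nat -> nat) (i : nat) := if i is j.+1 then nu j else k.

Fixpoint sat_mod M (a : nat -> nat) (l : seq constr) : Prop :=
  if l is c :: l' then
    match c with
    | EOne i => congn M (a i) 1
    | EAdd i j k => congn M (a i + a j) (a k)
    | EMul i j k => congn M (a i * a j) (a k)
    end /\ sat_mod M a l'
  else True.

(** The number [a i] codes the values of variable i for all k at once, through its residues. An
    unknown (odd i) has residues bounded via the binomial coefficient; the quantified variable (i =
    0) is coded by L', congruent to k modulo the k-th modulus; the other even positions hold
    constant parameters. *)
Definition var_ok M q L' (a nu : nat -> nat) i : Prop :=
  if odd i then M %| 'C(a i, q) : Prop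
  else if i./2 is j.+1 then a i = nu j /\ nu j < q else a i = L'.

(** Sums and products of residues below q stay below p, so congruences modulo p between them are
    equalities. *)
Lemma sat_of_sat_mod p M q a l N : 2 * q + q * q + 1 < p -> p %| M ->
  all (constr_lt N) l -> (forall i, i < N -> a i %% p < q) ->
  sat_mod M a l -> sat 1 addn muln (fun i => a i %% p) l.
Proof.
move=> qp pM + aq; elim: l => //= c l IH /andP[Hc /IH Hl] [H /Hl{}Hl]; split=> //.
have red x y : congn M x y -> x = y %[mod p].
  by move/congnP => E; rewrite -(modn_dvdm x pM) E modn_dvdm.
case: c Hc H => [i|i j k|i j k] /=.
- by move=> /aq Hi /red ->; rewrite modn_small //; clear -qp; lia.
- move=> /and3P[/aq Hi /aq Hj /aq Hk] /red <-; rewrite -modnDm [RHS]modn_small //.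
  by move: (a i %% p) (a j %% p) Hi Hj => x y; clear -qp; lia.
- move=> /and3P[/aq Hi /aq Hj /aq Hk] /red <-; rewrite -modnMm [RHS]modn_small //.
  apply: (@leq_ltn_trans (q * q)); last by lia.
  by apply: leq_mul; apply: ltnW.
Qed.

Lemma bounded_forall_sound l N n nu q w L' a : all (constr_lt N) l ->
  n <= q -> q * q + 2 * q + 3 <= w -> L'.+1 = w`! * w`! ->
  (forall i, i < N -> var_ok 'C(L', n) q L' a nu i) -> sat_mod 'C(L', n) a l ->
  forall k, k < n -> exists mu, sat 1 addn muln (interleave (scons k nu) mu) l.
Proof.
move=> lN nq qw EL Hv Hs k kn.
have w2 : 2 < w by lia.
have nw : n <= w by lia.
have kw : k < w by lia.
have L'E : L' = (w`! * w`!).-1 by rewrite -EL.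
(* The values for a given k are residues modulo a prime divisor p of the k-th modulus; all such
   primes exceed w. *)
have M1 := modulus_gt1 w2 kw; have pp := pdiv_prime M1; have pMk := pdiv_dvd (modulus w k).
set p := pdiv _ in pp pMk.
have wp := modulus_prime kw pp pMk.
have pM : p %| 'C(L', n).
  by rewrite L'E -prod_modulus // (dvdn_trans pMk) // (bigD1 (Ordinal kn)) //= dvdn_mulr.
have qp : q < p by clear -qw wp; lia.
have kq : k < q by apply: leq_trans nq.
have Lk : L' %% p = k by rewrite L'E (modulus_eqmod kw pMk) modn_small // (ltn_trans kq).
exists (fun j => a j.*2.+1 %% p).
apply: (@sat_eq_lt _ _ _ _ N (fun i => a i %% p)) => // [i iN|].
  have := Hv i iN; rewrite /var_ok /interleave; case: ifP => [oi _|ei].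
    by rewrite -[in LHS](odd_double_half i) oi.
  case E: i./2 => [|j] /=; first by move=> ->.
  by move=> [-> nq']; rewrite modn_small // (ltn_trans nq').
have qp' : 2 * q + q * q + 1 < p by clear -qw wp; lia.
apply: (sat_of_sat_mod qp' pM lN _ Hs).
move=> i iN; have := Hv i iN; rewrite /var_ok; case: ifP => [oi H|ei].
  by apply: bin_dvd_mod_lt => //; apply: dvdn_trans H.
case: (i./2) => [->|j [-> H]]; first by rewrite Lk.
by rewrite modn_small // (ltn_trans H).
Qed.

(** Choose unknowns for each k below n, let q exceed all values that occur, and glue the values of
    each unknown by the Chinese remainder theorem. The moduli are prime to q!, so small residues do
    give the binomial divisibility. *)
Lemma bounded_forall_complete l N n nu : all (constr_lt N) l ->
  (forall k, k < n -> exists mu, sat 1 addn muln (interleave (scons k nu) mu) l) ->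
  exists q w L' a, [/\ n <= q, q * q + 2 * q + 3 <= w, L'.+1 = w`! * w`!,
    forall i, i < N -> var_ok 'C(L', n) q L' a nu i & sat_mod 'C(L', n) a l].
Proof.
move=> lN /(fin_choice (fun=> 0))[F HF].
pose e k i := interleave (scons k nu) (F k) i.
have [q1 Hq1] := fin_bound2 n N e.
have [q2 Hq2] := fin_bound N nu.
pose q := q1 + q2 + n; pose w := q * q + 2 * q + 3; pose L' := (w`! * w`!).-1.
have nw : n <= w by lia.
have cM := modulus_coprime nw; have ME := prod_modulus nw; rewrite -/L' in ME.
have [c Hc] : exists c : nat -> nat, forall i, i < N ->
    forall k, k < n -> c i = e k i %[mod modulus w k].
  apply: (@fin_choice _ 0 _ (fun i x => forall k, k < n -> x = e k i %[mod modulus w k])) => i _.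
  exact: chinese_seq.
pose a i := if odd i then c i else if i./2 is j.+1 then nu j else L'.
have Ha i : i < N -> forall k, k < n -> a i = e k i %[mod modulus w k].
  move=> iN k kn; rewrite /a; case: ifP => oi; first exact: Hc.
  rewrite /e /interleave oi; case: (i./2) => [|j] //=.
  by apply: modulus_eqmod => //; apply: leq_trans nw.
exists q, w, L', a; split=> //.
- by rewrite leq_addl.
- by rewrite prednK // muln_gt0 fact_gt0.
- move=> i iN; have := Ha i iN; rewrite /var_ok; case: ifP => oi.
    move=> H; rewrite -ME; apply: prod_dvd => // k kn.
    apply: dvd_bin_of_eqmod (H k kn); first by have := Hq1 _ _ kn iN; rewrite /q; clear; lia.
    apply: coprime_fact_of_primes => p pp /(modulus_prime _ pp) => wp.
    by have := wp (leq_trans kn nw); clear; lia.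
  move=> _; rewrite /a oi; case E: (i./2) => [|j] //; split=> //.
  have jN : j < N by have := odd_double_half i; rewrite E; clear -iN; lia.
  by have := Hq2 j jN; rewrite /q; clear; lia.
- have {}HF k : k < n -> sat 1 addn muln (e k) l by move/HF.
  elim: l lN HF => //= d l IH /andP[dN lN] HF; split; last first.
    by apply: IH => // k kn; case: (HF k kn).
  case: d dN HF => [i|i j k|i j k] /=.
  + move=> iN HF; apply/congnP; rewrite -ME; apply: eqmod_prod => // m mn.
    by rewrite Ha //; case: (HF m mn) => ->.
  + move=> /and3P[iN jN kN] HF; apply/congnP; rewrite -ME; apply: eqmod_prod => // m mn.
    by rewrite -modnDm !(Ha _ _ m) // modnDm; case: (HF m mn) => ->.
  + move=> /and3P[iN jN kN] HF; apply/congnP; rewrite -ME; apply: eqmod_prod => // m mn.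
    by rewrite -modnMm !(Ha _ _ m) // modnMm; case: (HF m mn) => ->.
Qed.

Ltac nfun_ext ::= match goal with
 | |- dfun _ _ _ (fun nu => expn (S (@?f nu)) (@?g nu)) =>
     refine (nfun_expn (f := f) (g := g) _ _)
 | |- dfun _ _ _ (fun nu => factorial (@?f nu)) => refine (nfun_fact (f := f) _)
 | |- dfun _ _ _ (fun nu => binomial (@?f nu) (@?g nu)) =>
     refine (nfun_bin (f := f) (g := g) _ _)
 end.

Lemma ndio_sat_mod m (a : nat -> (nat -> nat) -> nat) l : nfun m -> (forall i, nfun (a i)) ->
  ndio (fun nu => sat_mod (m nu) (fun i => a i nu) l).
Proof.
move=> Hm Ha; elim: l => [|c l IH] /=; first exact: dio_true.
by case: c => *; apply: dio_and IH; ndio_tac.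
Qed.

Lemma ndio_forall_lt (Q : nat -> (nat -> nat) -> Prop) f : nfun f ->
  ndio (fun nu => Q (nu 0) (fun i => nu i.+1)) ->
  ndio (fun nu => forall k, k < f nu -> Q k nu).
Proof.
move=> Hf [l Hl]; have [N lN] := constr_bound l.
have QE k nu : Q k nu <-> exists mu, sat 1 addn muln (interleave (scons k nu) mu) l.
  exact: (Hl (scons k nu)).
apply: (@dio_iff _ _ _ _ (fun nu => exists q w L' a, f nu <= q /\ q * q + 2 * q + 3 <= w /\
    L'.+1 = w`! * w`! /\ (forall i, i < N -> var_ok 'C(L', f nu) q L' a nu i) /\
    sat_mod 'C(L', f nu) a l)); last first.
  move=> nu; split=> [[q [w [L' [a [h1 [h2 [h3 [h4 h5]]]]]]]] k kn|H].
    by apply/QE; apply: bounded_forall_sound kn; eauto.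
  have [|q [w [L' [a [h1 h2 h3 h4 h5]]]]] := @bounded_forall_complete l N (f nu) nu lN.
    by move=> k /H/QE.
  by exists q, w, L', a.
do 3 apply: dio_ex; apply: dio_exf.
do 3 (apply: dio_and; first by ndio_tac).
apply: dio_and; last first.
  by apply: (ndio_sat_mod (a := fun i nu => nu i.*2.+1)) => [|i]; nfun_tac.
(* N depends only on [l], so this is a finite conjunction fixed in advance. *)
apply: dio_forall_lt => i; rewrite /var_ok; case: (odd i); first by ndio_tac.
by case: (i./2) => [|j]; ndio_tac.
Qed.

(** * Graphs of partial recursive functions *)

Fixpoint all_prop (A : Type) (P : A -> Prop) (s : seq A) : Prop :=
  if s is x :: s' then P x /\ all_prop P s' else True.

Lemma recfun_nested_ind (P : recfun -> Prop) :
  P RZero -> P RSucc -> (forall i, P (RProj i)) ->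
  (forall f gs, P f -> all_prop P gs -> P (RComp f gs)) ->
  (forall f g, P f -> P g -> P (RPrim f g)) ->
  (forall f, P f -> P (RMu f)) -> forall f, P f.
Proof.
move=> H1 H2 H3 H4 H5 H6; fix IH 1; case=> [||i|f gs|f g|f].
- exact: H1.
- exact: H2.
- exact: H3.
- apply: H4; first exact: IH.
  by elim: gs => [|g gs IHg]; [exact: I|split; [exact: IH|exact: IHg]].
- by apply: H5; apply: IH.
- by apply: H6; apply: IH.
Qed.

Lemma evalrf_projE i v y : evalrf (RProj i) v y <-> i < size v /\ y = nth 0 v i.
Proof. by split=> [H|[H ->]]; [inversion H|exact: ev_proj]. Qed.

Lemma evalrf_compE f gs v y :
  evalrf (RComp f gs) v y <-> exists ws, evalrfs gs v ws /\ evalrf f ws y.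
Proof.
split=> [H|[ws [H1 H2]]]; last exact: ev_comp H1 H2.
by inversion H; subst; eauto.
Qed.

Lemma evalrfs_consE g gs v y ys :
  evalrfs (g :: gs) v (y :: ys) <-> evalrf g v y /\ evalrfs gs v ys.
Proof.
split=> [H|[H1 H2]]; last exact: evs_cons.
by inversion H; subst.
Qed.

Lemma evalrfs_size gs v ws : evalrfs gs v ws -> size ws = size gs.
Proof.
elim: gs ws => [|g gs IH] [|w ws] H //; try by inversion H.
by move: H => /evalrfs_consE[_ /IH] /= ->.
Qed.

Lemma evalrf_prim_seq f g k v (c : nat -> nat) : evalrf f v (c 0) ->
  (forall i, i < k -> evalrf g (i :: c i :: v) (c i.+1)) -> evalrf (RPrim f g) (k :: v) (c k).
Proof.
move=> H0; elim: k => [|k IH] H; first exact: ev_prim0.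
by apply: ev_primS (H k _) => //; apply: IH => i ik; apply: H; apply: ltnW.
Qed.

Lemma evalrf_prim0_inv f g v y : evalrf (RPrim f g) (0 :: v) y -> evalrf f v y.
Proof. by move=> H; inversion H. Qed.

Lemma evalrf_primS_inv f g k v z : evalrf (RPrim f g) (k.+1 :: v) z ->
  exists y, evalrf (RPrim f g) (k :: v) y /\ evalrf g (k :: y :: v) z.
Proof. by move=> H; inversion H; subst; eauto. Qed.

Lemma evalrf_prim_ex f g k v y : evalrf (RPrim f g) (k :: v) y -> exists c : nat -> nat,
  [/\ evalrf f v (c 0), forall i, i < k -> evalrf g (i :: c i :: v) (c i.+1) & y = c k].
Proof.
elim: k y => [|k IH] y; first by move=> /evalrf_prim0_inv; exists (fun=> y).
move=> /evalrf_primS_inv[y' [/IH[c [h1 h2 h3]] Hy]].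
exists (fun i => if i == k.+1 then y else c i); split=> //; last by rewrite eqxx.
move=> i; rewrite ltnS leq_eqVlt => /predU1P[->|ik].
  by rewrite eqxx (ltn_eqF (ltnSn k)) -h3.
by rewrite eqSS (ltn_eqF ik) (ltn_eqF (leqW ik)); apply: h2.
Qed.

Lemma evalrf_muE f v n : evalrf (RMu f) v n <->
  evalrf f (n :: v) 0 /\ forall m, m < n -> exists k, evalrf f (m :: v) k.+1.
Proof.
split=> [H|[H1 H2]]; last exact: ev_mu.
by inversion H; subst.
Qed.

Lemma evalrf_det f v y y' : evalrf f v y -> evalrf f v y' -> y = y'.
Proof.
elim/recfun_nested_ind: f v y y' => [||i|f gs IHf IHgs|f g IHf IHg|f IHf] v y y'.
- by move=> H H'; inversion H; inversion H'.
- by move=> H H'; inversion H; subst; inversion H'.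
- by move=> H H'; inversion H; inversion H'; subst.
- move=> /evalrf_compE[ws [h1 h2]] /evalrf_compE[ws' [h1' h2']].
  suff E : ws = ws' by subst; apply: IHf h2 h2'.
  elim: gs IHgs ws ws' h1 h1' {h2 h2'} => [|g gs IH] /= IHgs ws ws' h1 h1'.
    by inversion h1; inversion h1'.
  inversion h1; inversion h1'; subst; case: IHgs => IHg IHgs.
  by congr (_ :: _); [apply: IHg; eauto|apply: IH; eauto].
- case: v => [H|k v]; first by inversion H.
  elim: k y y' => [|k IH] y y'.
    by move=> /evalrf_prim0_inv h /evalrf_prim0_inv; apply: IHf.
  move=> /evalrf_primS_inv[z [hz h]] /evalrf_primS_inv[z' [hz' h']].
  by move: h'; rewrite -(IH _ _ hz hz'); apply: IHg.
- move=> /evalrf_muE[h1 h2] /evalrf_muE[h1' h2'].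
  case: (ltngtP y y') => // lt.
    by have [k /(IHf _ _ _ h1)] := h2' _ lt.
  by have [k /(IHf _ _ _ h1')] := h2 _ lt.
Qed.

Lemma mkseq_cons (A : Type) (f : nat -> A) n :
  mkseq f n.+1 = f 0 :: mkseq (fun i => f i.+1) n.
Proof. by rewrite /mkseq /= (iotaDl 1 0) -map_comp. Qed.

Lemma ndio_false : ndio (fun=> False).
Proof. by apply: (@dio_iff _ _ _ _ (fun=> 0 = 1)) => //; ndio_tac. Qed.

(** Plays the part of Gödel's beta function; the base [B.+1] is never zero. *)
Definition digit C B i := (C %/ B.+1 ^ i) %% B.+1.

Lemma nfun_digit f g h : nfun f -> nfun g -> nfun h ->
  nfun (fun nu => digit (f nu) (g nu) (h nu)).
Proof.
move=> Hf Hg Hh; apply: nfun_modn => [||nu] //; last by nfun_tac.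
by apply: nfun_divn => [||nu]; [|nfun_tac|rewrite expn_gt0].
Qed.

Lemma digit_code k (c : nat -> nat) : exists C B, forall i, i < k -> digit C B i = c i.
Proof.
have [B HB] := fin_bound k c.
exists (\sum_(i < k) (if i < k then c i else 0) * B.+1 ^ i), B => i ik; rewrite /digit.
rewrite (@digit_sum _ _ (fun i => if i < k then c i else 0)) ?ik // => j.
by case: ifP => [/HB/ltnW|].
Qed.

Ltac nfun_ext ::= match goal with
 | |- dfun _ _ _ (fun nu => digit (@?f nu) (@?g nu) (@?h nu)) =>
     refine (nfun_digit (f := f) (g := g) (h := h) _ _ _)
 | |- dfun _ _ _ (fun nu => expn (S (@?f nu)) (@?g nu)) =>
     refine (nfun_expn (f := f) (g := g) _ _)
 end.

(** One statement for each number n of arguments, as a [recfun] carries no arity. *)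
Definition graph_dio f :=
  forall n, ndio (fun nu => evalrf f (mkseq (fun i => nu i.+1) n) (nu 0)).

Lemma graph_dio_ren f n (r : nat -> nat) j : graph_dio f ->
  ndio (fun nu => evalrf f (mkseq (fun i => nu (r i)) n) (nu j)).
Proof. by move=> /(_ n)/(dio_ren (fun i => if i is k.+1 then r k else j)). Qed.

Lemma graphs_dio gs n (r s : nat -> nat) : all_prop graph_dio gs ->
  ndio (fun nu => evalrfs gs (mkseq (fun i => nu (r i)) n) (mkseq (fun i => nu (s i)) (size gs))).
Proof.
elim: gs s => [|g gs IH] s /= => [_|[Hg Hgs]].
  by apply: dio_iff (dio_true _ _ _) _ => nu; split=> // _; apply: evs_nil.
apply: dio_iff (dio_and (graph_dio_ren n r (s 0) Hg) (IH (fun i => s i.+1) Hgs)) _ => nu.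
by rewrite mkseq_cons evalrfs_consE.
Qed.

Lemma graph_dio_comp f gs : graph_dio f -> all_prop graph_dio gs -> graph_dio (RComp f gs).
Proof.
move=> Hf Hgs n.
apply: (@dio_iff _ _ _ _ (fun nu => exists mu,
  evalrfs gs (mkseq (fun i => nu i.+1) n) (mkseq mu (size gs)) /\
  evalrf f (mkseq mu (size gs)) (nu 0))); last first.
  move=> nu; rewrite evalrf_compE; split=> [[mu H]|[ws [H1 H2]]]; first by eexists; exact: H.
  by exists (nth 0 ws); rewrite -(evalrfs_size H1) mkseq_nth.
apply: dio_exf; apply: dio_and.
  exact: (graphs_dio n (fun i => i.+1.*2) (fun i => i.*2.+1) Hgs).
exact: (graph_dio_ren (size gs) (fun i => i.*2.+1) 0.*2 Hf).
Qed.

(** The intermediate values of the recursion are digits of one number C, and a bounded quantifier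
    states that each step follows from the previous one. *)
Lemma graph_dio_prim f g : graph_dio f -> graph_dio g -> graph_dio (RPrim f g).
Proof.
move=> Hf Hg [|n].
  by apply: dio_iff ndio_false _ => nu; split=> // H; inversion H.
apply: (@dio_iff _ _ _ _ (fun nu => exists C B,
   (exists p, p = digit C B 0 /\ evalrf f (mkseq (fun i => nu i.+2) n) p) /\
   nu 0 = digit C B (nu 1) /\
   forall i, i < nu 1 -> exists p q, p = digit C B i /\ q = digit C B i.+1 /\
     evalrf g (i :: p :: mkseq (fun i => nu i.+2) n) q)); last first.
  move=> nu; rewrite mkseq_cons; split=> [[C [B [[p [-> H1]] [-> H2]]]]|].
    apply: (@evalrf_prim_seq f g _ _ (digit C B)) => // i /H2.
    by move=> [p' [q [-> [-> //]]]].
  move=> /evalrf_prim_ex[c [H1 H2 ->]].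
  have [C [B E]] := digit_code (nu 1).+1 c.
  exists C, B; split; first by exists (c 0); rewrite E.
  split; first by rewrite E.
  move=> i ik; exists (c i), (c i.+1); rewrite !E //; first by split=> //; split=> //; apply: H2.
  exact: ltnW.
do 2 apply: dio_ex; apply: dio_and; last (apply: dio_and; first by ndio_tac).
  apply: dio_ex; apply: dio_and; first by ndio_tac.
  exact: (graph_dio_ren n (fun i => i.+2.+3) 0 Hf).
apply: (ndio_forall_lt (f := fun nu => nu 3) (Q := fun i nu => exists p q,
   p = digit (nu 1) (nu 0) i /\ q = digit (nu 1) (nu 0) i.+1 /\
     evalrf g (i :: p :: mkseq (fun i => nu i.+2.+2) n) q)); first by nfun_tac.
do 2 apply: dio_ex; do 2 (apply: dio_and; first by ndio_tac).
(* Positions 0 to 4 hold [q], [p], [i], [B] and [C]; the original parameters start at 5, two of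
   which precede the remaining arguments. *)
pose r i := match i with 0 => 2 | 1 => 1 | j.+2 => (j.+2.+2).+3 end.
by apply: dio_iff (graph_dio_ren n.+2 r 0 Hg) _ => nu; rewrite !mkseq_cons.
Qed.

Lemma graph_dio_mu f : graph_dio f -> graph_dio (RMu f).
Proof.
move=> Hf n.
apply: (@dio_iff _ _ _ _ (fun nu =>
   (exists z, z = 0 /\ evalrf f (nu 0 :: mkseq (fun i => nu i.+1) n) z) /\
   forall m, m < nu 0 -> exists k z, z = k.+1 /\ evalrf f (m :: mkseq (fun i => nu i.+1) n) z)).
  apply: dio_and.
    apply: dio_ex; apply: dio_and; first by ndio_tac.
    pose r i := if i is j.+1 then j.+2 else 1.
    by apply: dio_iff (graph_dio_ren n.+1 r 0 Hf) _ => nu; rewrite mkseq_cons.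
  apply: (ndio_forall_lt (f := fun nu => nu 0) (Q := fun m nu => exists k z, z = k.+1 /\
    evalrf f (m :: mkseq (fun i => nu i.+1) n) z)); first by nfun_tac.
  do 2 apply: dio_ex; apply: dio_and; first by ndio_tac.
  pose r i := if i is j.+1 then j.+4 else 2.
  by apply: dio_iff (graph_dio_ren n.+1 r 0 Hf) _ => nu; rewrite mkseq_cons.
move=> nu; rewrite evalrf_muE; split=> [[[z [-> H1]] H2]|[H1 H2]]; split=> //.
- by move=> m /H2[k [z' [-> H]]]; exists k.
- by exists 0.
- by move=> m /H2[k H]; exists k, k.+1.
Qed.

Theorem graph_dio_recfun f : graph_dio f.
Proof.
elim/recfun_nested_ind: f => [|||f gs|f g|f].
- move=> n; apply: (@dio_iff _ _ _ _ (fun nu => nu 0 = 0)); first by ndio_tac.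
  by move=> nu; split=> [->|H]; [apply: ev_zero|inversion H].
- case=> [|n]; first by apply: dio_iff ndio_false _ => nu; split=> // H; inversion H.
  apply: (@dio_iff _ _ _ _ (fun nu => nu 0 = (nu 1).+1)); first by ndio_tac.
  move=> nu; rewrite mkseq_cons; split=> [->|H]; [exact: ev_succ|by inversion H].
- move=> i n; case: (ltnP i n) => [lin|nin].
    apply: (@dio_iff _ _ _ _ (fun nu => nu 0 = nu i.+1)); first by ndio_tac.
    by move=> nu; rewrite evalrf_projE size_mkseq nth_mkseq // lin; split=> [|[]].
  by apply: dio_iff ndio_false _ => nu; rewrite evalrf_projE size_mkseq ltnNge nin; split=> [|[]].
- exact: graph_dio_comp.
- exact: graph_dio_prim.
- exact: graph_dio_mu.
Qed.

(** * Natural numbers among the integers *)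

Lemma sqr_mod_inj p h i j : prime p -> p = h.*2.+1 -> i <= h -> j <= h ->
  i * i = j * j %[mod p] -> i = j.
Proof.
move=> pp ph; wlog ij : i j / i <= j => [W ih jh E|ih jh E].
  by case: (leqP i j) => [/W|/ltnW/W]; [|move=> V; symmetry]; auto.
have : p %| (j - i) * (j + i).
  rewrite -subn_sqr !expnS !muln1 -eqn_mod_dvd ?leq_mul //; exact/eqP/esym.
rewrite Euclid_dvdM // => /orP[] /dvdnP[[|c]]; rewrite ?mul0n ?mulSn; clear -ph ij ih jh; lia.
Qed.

(** Pigeonhole: with p = 2h + 1 and i, j from 0 to h, the squares i^2 and the numbers -1 - j^2 make
    p + 1 residues. Equality within one family is excluded by [sqr_mod_inj], so two residues from
    different families agree. *)
Lemma prime_dvd_two_sqrS p : prime p -> odd p ->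
  exists a b m, [/\ a * a + b * b + 1 = m * p, 0 < m & m < p].
Proof.
move=> pp op; pose h := p./2.
have ph : p = h.*2.+1 by rewrite -[LHS]odd_double_half op.
have p0 : 0 < p by rewrite ph.
have h0 : 0 < h by have := prime_gt1 pp; rewrite ph; clear; lia.
have mlt x : x %% p < p by rewrite ltn_mod.
(* The summand [p * p] keeps -1 - j^2 nonnegative. *)
pose F (x : 'I_h.+1 + 'I_h.+1) : 'I_p :=
  match x with
  | inl i => Ordinal (mlt (i * i))
  | inr j => Ordinal (mlt (p * p - 1 - j * j))
  end.
have bnd i : i <= h -> i * i + 1 <= p * p by move=> ih; rewrite ph; nia.
have mixed i j : i <= h -> j <= h -> i * i = p * p - 1 - j * j %[mod p] ->
    exists a b m, [/\ a * a + b * b + 1 = m * p, 0 < m & m < p].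
  move=> ih jh E.
  have /dvdnP[m Em] : p %| i * i + j * j + 1.
    have jb := bnd j jh.
    rewrite /dvdn -addnA -modnDml E modnDml.
    by rewrite (_ : p * p - 1 - j * j + (j * j + 1) = p * p) ?modnMl //; clear -jb; lia.
  exists i, j, m; split=> //; first by case: m Em => //; clear; lia.
  rewrite -(ltn_pmul2r p0) -Em ph; clear -ih jh h0.
  have : i * i <= h * h by apply: leq_mul.
  have : j * j <= h * h by apply: leq_mul.
  by rewrite -muln2 => ? ?; nia.
have [/injectiveP injF|/injectivePn[x [y xy E]]] := boolP (injectiveb F).
  by have := leq_card F injF; rewrite card_sum !card_ord ph -addnn; lia.
have lo (i : 'I_h.+1) : i <= h by rewrite -ltnS ltn_ord.
case: x y xy E => [i|i] [j|j] xy /(congr1 val) /= E.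
- case/eqP: xy; congr inl; apply: val_inj; exact: (sqr_mod_inj pp ph (lo i) (lo j) E).
- exact: (mixed _ _ (lo i) (lo j) E).
- exact: (mixed _ _ (lo j) (lo i) (esym E)).
- case/eqP: xy; congr inr; apply: val_inj; apply: (sqr_mod_inj pp ph (lo i) (lo j)).
  have ib := bnd _ (lo i); have jb := bnd _ (lo j).
  have /eqP : p * p - 1 - i * i + (i * i + j * j) = p * p - 1 - j * j + (i * i + j * j) %[mod p].
    by apply/eqP; rewrite eqn_modDr; apply/eqP.
  rewrite (_ : _ + _ = p * p - 1 + j * j); last by clear -ib; lia.
  rewrite (_ : p * p - 1 - j * j + _ = p * p - 1 + i * i); last by clear -jb; lia.
  by rewrite eqn_modDl => /eqP/esym.
Qed.

Section SumsOfSquares.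
Local Open Scope ring_scope.

Definition sum4sqr (n : int) := exists a b c d, n = a * a + b * b + c * c + d * d.

(** Euler's four-square identity. *)
Lemma sum4sqr_mul m n : sum4sqr m -> sum4sqr n -> sum4sqr (m * n).
Proof.
move=> [a [b [c [d ->]]]] [e [f [g [h ->]]]].
exists (a * e + b * f + c * g + d * h), (a * f - b * e + c * h - d * g),
  (a * g - b * h - c * e + d * f), (a * h + b * g - c * f - d * e).
by ring.
Qed.

(* Allowing the square factor [s * s] replaces the descent in Lagrange's theorem by strong induction. *)
Lemma four_square_rational (n : nat) : (0 < n)%N ->
  exists2 s : int, s != 0 & sum4sqr (n%:Z * (s * s)).
Proof.
elim/ltn_ind: n => n IH n0.
have [n1|n1] : n = 1%N \/ (1 < n)%N by lia.
  by rewrite n1; exists 1 => //; exists 1, 0, 0, 0.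
have pp := pdiv_prime n1; have /dvdnP[e nE] := pdiv_dvd n; set p := pdiv n in pp nE.
have p1 := prime_gt1 pp.
have [e1|e1] : e = 1%N \/ (1 < e)%N by nia.
  have {}nE : n = p by rewrite nE e1 mul1n.
  case: (boolP (odd p)) => [op|/negbTE ep]; last first.
    have -> : n = 2%N by rewrite nE; apply/(prime_oddPn pp); rewrite ep.
    by exists 1 => //; exists 1, 1, 0, 0.
  have [a [b [m [Em m0 mp]]]] := prime_dvd_two_sqrS pp op.
  have [|//|s s0 Hs] := IH m; first by rewrite nE.
  (* Here mn is a sum of four squares by construction and m s^2 by induction; their product is n
     (ms)^2. *)
  exists (m%:Z * s); first by rewrite mulf_neq0 //; lia.
  rewrite (_ : _ * _ = (m%:Z * n%:Z) * (m%:Z * (s * s))); last by ring.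
  apply: sum4sqr_mul => //; exists a%:Z, b%:Z, 1, 0; rewrite nE; lia.
have [||s s0 Hs] := IH p; [by nia|by lia|].
have [||r r0 Hr] := IH e; [by nia|by lia|].
exists (s * r); first by rewrite mulf_neq0.
rewrite nE (_ : _ * _ = (p%:Z * (s * s)) * (e%:Z * (r * r))); last by rewrite PoszM; ring.
exact: sum4sqr_mul.
Qed.

(** This makes nonvanishing existential, since (2i+1)(3j+1) is never zero. Doubling preserves the
    form: 2(3j+1) = -(3(-2j-1) + 1), and the sign goes into the odd factor. *)
Lemma intn0_factor (s : int) : s != 0 -> exists i j, s = (i + i + 1) * (j + j + j + 1).
Proof.
move: {2}`|s|%N (leqnn `|s|%N) => n; elim: n s => [|n IH] s sn s0; first by lia.
have [[i E]|[s' E]] : (exists i, s = i + i + 1) \/ (exists s', s = s' + s').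
  have := divz_eq s 2; have : (s %% 2)%Z = 0 \/ (s %% 2)%Z = 1 by lia.
  by move=> [->|->] E; [right|left]; exists (s %/ 2)%Z; lia.
- by exists i, 0; rewrite E; ring.
- have [||i [j E']] := IH s'; [by lia|by lia|].
  by exists (- i - 1), (- j - j - 1); rewrite E E'; ring.
Qed.

Lemma int_ge0P (z : int) : 0 <= z <-> exists i j a b c d,
  z * (((i + i + 1) * (j + j + j + 1)) * ((i + i + 1) * (j + j + j + 1))) =
  a * a + b * b + c * c + d * d.
Proof.
split=> [|[i [j [a [b [c [d E]]]]]]].
  case: z => // -[|n] _.
    by exists 0, 0, 0, 0, 0, 0.
  have [s /intn0_factor[i [j ->]] [a [b [c [d H]]]]] := four_square_rational (ltn0Sn n).
  by exists i, j, a, b, c, d.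
have s0 : (i + i + 1) * (j + j + j + 1) != 0 by rewrite mulf_neq0 //; lia.
move: (_ * _) s0 E => s s0 E.
rewrite leNgt; apply/negP => z0.
have : 0 < s * s by rewrite -expr2 exprn_even_gt0.
have : 0 <= a * a + b * b + c * c + d * d by rewrite -!expr2 !addr_ge0 // sqr_ge0.
by nia.
Qed.

End SumsOfSquares.

Notation zsat := (@sat int 1%R +%R *%R).
Notation zdio := (@dio int 1%R +%R *%R).

Ltac zfun_tac := lazy beta; match goal with
 | |- dfun _ _ _ (fun nu => nu ?i) => refine (dfun_var _ (@mulr1 _) i)
 | |- dfun _ _ _ (fun _ => 1%R) => refine (dfun_one _ _ _)
 | |- dfun _ _ _ (fun nu => (@?f nu + @?g nu)%R) =>
     refine (dfun_add (f := f) (g := g) _ _); zfun_tac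
 | |- dfun _ _ _ (fun nu => (@?f nu * @?g nu)%R) =>
     refine (dfun_mul (f := f) (g := g) _ _); zfun_tac
 end.

Lemma zdio_ge0 i : zdio (fun nu => (0 <= nu i)%R).
Proof.
apply: dio_iff (fun nu => iff_sym (int_ge0P (nu i))).
do 6 apply: dio_ex; apply: dio_eq; first exact: mulr1; by zfun_tac.
Qed.

Lemma zdio_sat l : zdio (fun nu => zsat nu l).
Proof.
by elim: l => [|c l IH]; [exact: dio_true|apply: dio_and IH; exact: dio_holds].
Qed.

Lemma zsat_Posz v l : zsat (fun i => Posz (v i)) l <-> sat 1 addn muln v l.
Proof.
elim: l => //= c l IH; rewrite IH.
case: c => [i|i j k|i j k] /=; rewrite -?PoszD -?PoszM; split=> -[]; split=> //; lia.
Qed.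

(** The constraints are read over the integers, with nonnegativity imposed on the finitely many
    variables that may occur in them. *)
Lemma ndio_zsat (P : nat -> Prop) : ndio (fun nu => P (nu 0)) ->
  exists l, forall k, P k <-> exists v : nat -> int, v 0 = Posz k /\ zsat v l.
Proof.
move=> [l0 H0]; have [N lN] := constr_bound l0.
have [l1 H1] : zdio (fun nu => zsat nu l0 /\ forall i, i < N -> (0 <= nu i)%R).
  by apply: dio_and; [exact: zdio_sat|apply: dio_forall_lt; exact: zdio_ge0].
exists l1 => k; split=> [Pk|[v [v0]]].
  have /H0[mu Hmu] := Pk : P ((fun=> k) 0).
  pose nu i := Posz (interleave (fun=> k) mu i).
  have /H1[ka Hka] : zsat nu l0 /\ forall i, i < N -> (0 <= nu i)%R.
    by split=> //; apply/zsat_Posz.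
  by exists (interleave nu ka).
rewrite -[v]interleave_split => Hv.
have /H1[Hs Hn] : exists ka, zsat (interleave (fun i => v i.*2) ka) l1 by eexists; exact: Hv.
pose u i := absz (v i.*2).
have Hu : sat 1 addn muln u l0.
  apply/zsat_Posz; apply: sat_eq_lt lN _ Hs => i iN.
  by rewrite /u gez0_abs // Hn.
have /H0 : exists mu, sat 1 addn muln (interleave (fun i => u i.*2) mu) l0.
  by exists (fun i => u i.*2.+1); rewrite interleave_split.
by rewrite /u /= v0.
Qed.

(** * The group *)

Section PresentedGroup.
Variables (A : eqType) (R : seq (word A)).
Implicit Types (u v w g h : word A).
Local Notation "u ~~ v" := (pres_eq R u v) (at level 70).

#[local] Hint Extern 0 (pres_eq _ _ _) => exact (pe_refl _ _) : core.

Lemma pres_eq_trans u v w : u ~~ v -> v ~~ w -> u ~~ w.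
Proof. by elim=> // w1 w2 w3 S _ IH /IH; apply: pe_step. Qed.

Lemma pres_step_eq u v : pres_step R u v -> u ~~ v.
Proof. by move=> S; apply: pe_step S (pe_refl _ _). Qed.

Lemma pres_eq_sym u v : u ~~ v -> v ~~ u.
Proof.
elim=> [w|w1 w2 w3 S _ IH]; first by [].
by apply: pres_eq_trans IH _; apply: pres_step_eq; apply: ps_sym.
Qed.

Lemma pres_step_ctx p q u v : pres_step R u v -> pres_step R (p ++ u ++ q) (p ++ v ++ q).
Proof.
elim=> [a b l|a b r H|a b r H|w1 w2 _ IH]; last exact: ps_sym.
- by rewrite -!catA !(catA p a); apply: ps_free.
- by rewrite -!catA !(catA p a); apply: ps_rel.
- by rewrite -!catA !(catA p a); apply: ps_relinv.
Qed.

Lemma pres_eq_ctx p q u v : u ~~ v -> p ++ u ++ q ~~ p ++ v ++ q.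
Proof.
elim=> [w|w1 w2 w3 S _ IH]; first by [].
exact: pe_step (pres_step_ctx _ _ S) IH.
Qed.

Lemma pres_eq_cat u u' v v' : u ~~ u' -> v ~~ v' -> u ++ v ~~ u' ++ v'.
Proof.
move=> /(pres_eq_ctx [::] v) H1 /(pres_eq_ctx u' [::]); rewrite !cats0.
exact: pres_eq_trans.
Qed.

#[local] Instance pres_eq_equiv : Equivalence (pres_eq R).
Proof. by split; [exact: pe_refl|exact: pres_eq_sym|exact: pres_eq_trans]. Qed.

#[local] Instance cat_pres_eq : Proper (pres_eq R ==> pres_eq R ==> pres_eq R) (@cat (A * bool)).
Proof. by move=> u u' Hu v v' Hv; apply: pres_eq_cat. Qed.

Lemma letter_invK : involutive (@letter_inv A).
Proof. by case=> a b; rewrite /letter_inv /= negbK. Qed.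

Lemma word_invK : involutive (@word_inv A).
Proof. by move=> w; rewrite /word_inv map_rev revK (mapK letter_invK). Qed.

Lemma word_inv_cat u v : word_inv (u ++ v) = word_inv v ++ word_inv u.
Proof. by rewrite /word_inv map_cat rev_cat. Qed.

Lemma cat_word_inv w : w ++ word_inv w ~~ [::].
Proof.
elim: w => [|l w IH]; first by [].
rewrite -cat1s word_inv_cat -catA (catA w) IH cat0s.
by apply: pres_eq_sym; apply: pres_step_eq; exact: (ps_free R [::] [::] l).
Qed.

Lemma word_inv_catl w : word_inv w ++ w ~~ [::].
Proof. by have := cat_word_inv (word_inv w); rewrite word_invK. Qed.

Lemma cat_word_invK w u : w ++ word_inv w ++ u ~~ u.
Proof. by rewrite catA cat_word_inv. Qed.

Lemma word_inv_catK w u : word_inv w ++ w ++ u ~~ u.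
Proof. by rewrite catA word_inv_catl. Qed.

Lemma cat_word_inv_nil u v : u ++ word_inv v ~~ [::] <-> u ~~ v.
Proof.
split=> [H|->]; last exact: cat_word_inv.
by rewrite -[u]cats0 -(word_inv_catl v) catA H.
Qed.

#[local] Instance word_inv_pres_eq : Proper (pres_eq R ==> pres_eq R) (@word_inv A).
Proof.
move=> u v uv.
by rewrite -[word_inv u]cats0 -(cat_word_inv v) -{1}uv word_inv_catK.
Qed.

(** Expresses g u g^-1 = v without inverses; [conjby g u u] is commutation. *)
Definition conjby g u v := g ++ u ~~ v ++ g.

#[local] Instance conjby_pres_eq :
  Proper (pres_eq R ==> pres_eq R ==> pres_eq R ==> iff) conjby.
Proof. by move=> g g' Hg u u' Hu v v' Hv; rewrite /conjby Hg Hu Hv. Qed.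

Lemma conjby_nil g : conjby g [::] [::].
Proof. by rewrite /conjby cats0. Qed.

Lemma conjby_cat g u v u' v' : conjby g u v -> conjby g u' v' -> conjby g (u ++ u') (v ++ v').
Proof. by rewrite /conjby => H H'; rewrite catA H -catA H' catA. Qed.

Lemma conjby_inv g u v : conjby g u v -> conjby g (word_inv u) (word_inv v).
Proof.
rewrite /conjby => H.
by rewrite -(word_inv_catK v (g ++ word_inv u)) (catA v) -H -(catA g) cat_word_inv cats0.
Qed.

Lemma conjby_comp g h u v w : conjby g u v -> conjby h v w -> conjby (h ++ g) u w.
Proof. by rewrite /conjby => H H'; rewrite -catA H catA H' catA. Qed.

Lemma conjby_sym g u v : conjby g u v -> conjby (word_inv g) v u.
Proof.
rewrite /conjby => H.
rewrite -[word_inv g ++ v]cats0 -(cat_word_inv g) -catA (catA v) -H -catA.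
by rewrite word_inv_catK.
Qed.

Lemma conjby_idP g u : conjby g u u -> conjby u g g.
Proof. exact: pres_eq_sym. Qed.

Lemma conjbyE g u v : conjby g u v -> g ++ u ++ word_inv g ~~ v.
Proof. by rewrite /conjby => H; rewrite catA H -catA cat_word_inv cats0. Qed.

Definition wpow w (z : int) : word A :=
  match z with
  | Posz n => flatten (nseq n w)
  | Negz n => flatten (nseq n.+1 (word_inv w))
  end.

Lemma wpowS w z : wpow w (z + 1)%R ~~ w ++ wpow w z.
Proof.
case: z => n; first by rewrite -PoszD addn1.
rewrite NegzE; case: n => [|n].
  by rewrite addNr /= cats0 cat_word_inv.
rewrite (_ : - n.+2%:Z + 1 = Negz n)%R; last by lia.
by rewrite -NegzE /= cat_word_invK.
Qed.

Lemma wpowB1 w z : wpow w (z - 1)%R ~~ word_inv w ++ wpow w z.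
Proof. by rewrite -[in wpow w z](subrK 1%R z) wpowS word_inv_catK. Qed.

Lemma int_succ_pred_ind (P : int -> Prop) : P 0%R ->
  (forall z, P z -> P (z + 1)%R) -> (forall z, P z -> P (z - 1)%R) -> forall z, P z.
Proof.
move=> P0 PS PP; elim/int_rect => // n IH.
  by rewrite -addn1 PoszD; apply: PS.
by rewrite (_ : - n.+1%:Z = - n%:Z - 1)%R; [apply: PP|lia].
Qed.

Lemma wpowD w a b : wpow w (a + b)%R ~~ wpow w a ++ wpow w b.
Proof.
elim/int_succ_pred_ind: a => [|a IH|a IH]; first by rewrite add0r.
  by rewrite addrAC !wpowS IH catA.
by rewrite addrAC !wpowB1 IH catA.
Qed.

Lemma wpowN w a : wpow w (- a)%R ~~ word_inv (wpow w a).
Proof.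
apply/cat_word_inv_nil; by rewrite word_invK -wpowD addNr.
Qed.

Lemma wpowM w a b : wpow (wpow w a) b ~~ wpow w (a * b)%R.
Proof.
elim/int_succ_pred_ind: b => [|b IH|b IH]; first by rewrite mulr0.
  by rewrite wpowS IH mulrDr mulr1 addrC wpowD.
by rewrite wpowB1 IH mulrBr mulr1 addrC wpowD wpowN.
Qed.

Lemma conjby_wpow g u v z : conjby g u v -> conjby g (wpow u z) (wpow v z).
Proof.
move=> H; elim/int_succ_pred_ind: z => [|z IH|z IH]; first exact: conjby_nil.
  by rewrite !wpowS; apply: conjby_cat.
by rewrite !wpowB1; apply: conjby_cat => //; apply: conjby_inv.
Qed.

Lemma wpow_cat u v z : conjby u v v -> wpow (u ++ v) z ~~ wpow u z ++ wpow v z.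
Proof.
move=> H; elim/int_succ_pred_ind: z => [|z IH|z IH]; first by [].
  rewrite !wpowS IH -!catA (catA v).
  have /conjby_idP/(@conjby_wpow v u u z) -> := H.
  by rewrite -!catA.
rewrite !wpowB1 IH word_inv_cat -!catA.
have Hz := conjby_idP H.
have : conjby (word_inv v) (word_inv u ++ wpow u z) (word_inv u ++ wpow u z).
  by apply: conjby_sym; apply: conjby_cat; [apply: conjby_inv|apply: conjby_wpow].
rewrite /conjby -catA => E.
by rewrite (catA (word_inv u)) (catA (word_inv v)) E -!catA.
Qed.

(** Each conjugation by x contributes one more factor c, which x fixes. *)
Lemma conjby_wpowl x y c a : conjby x c c -> conjby x y (c ++ y) ->
  conjby (wpow x a) y (wpow c a ++ y).
Proof.
move=> xc xy; have xc' z := conjby_wpow z xc.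
elim/int_succ_pred_ind: a => [|a IH|a IH]; first by rewrite /conjby cats0.
  rewrite wpowS [wpow c _]wpowS; apply: conjby_comp IH _.
  have : wpow c (a + 1)%R ++ y ~~ wpow c a ++ (c ++ y).
    by rewrite wpowD /= cats0 -catA.
  by rewrite wpowS => ->; apply: conjby_cat.
rewrite wpowB1; apply: conjby_comp IH _; apply: conjby_sym.
have : wpow c a ++ y ~~ wpow c (a - 1)%R ++ (c ++ y).
  by rewrite -{1}(subrK 1%R a) (wpowD _ (a - 1)%R 1%R) /= cats0 -catA.
by move=> ->; apply: conjby_cat.
Qed.

(** Conjugation by x^a turns y^b into (c^a y)^b, which is c^(ab) y^b because y commutes with c. *)
Lemma commutator_wpow x y c a b : conjby x c c -> conjby y c c -> conjby x y (c ++ y) ->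
  wpow x a ++ wpow y b ++ word_inv (wpow x a) ++ word_inv (wpow y b) ~~ wpow c (a * b)%R.
Proof.
move=> xc yc xy; have := conjby_wpow b (conjby_wpowl a xc xy).
rewrite wpow_cat; last by apply: conjby_idP; apply: conjby_wpow.
rewrite wpowM => /conjbyE.
move: (wpow x a) (word_inv (wpow x a)) (wpow y b) => u u' v E.
rewrite (_ : u ++ _ = (u ++ v ++ u') ++ word_inv v); last by rewrite -!catA.
by rewrite E -catA cat_word_inv cats0.
Qed.

End PresentedGroup.

Section K2Group.
Local Open Scope ring_scope.
Implicit Types (g h : int * int * int * bool) (w : word K2gen).

(* [(a, b, c, e)] stands for [y^b x^a z^c t^e] with [y = t x t^-1] and [z = [x, y]]. *)
Definition K2mul g h :=
  let: (a, b, c, e) := g in let: (a', b', c', e') := h in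
  if e then (a + b', b + a', c + (a' * b' - c') + a * a', ~~ e')
  else (a + a', b + b', c + c' + a * b', e').

Definition K2one : int * int * int * bool := (0, 0, 0, false).

Definition K2inv g :=
  let: (a, b, c, e) := g in
  if e then (- b, - a, c, true) else (- a, - b, a * b - c, false).

Lemma K2mulA g h k : K2mul g (K2mul h k) = K2mul (K2mul g h) k.
Proof.
case: g => [[[a b] c] []]; case: h => [[[a' b'] c'] []]; case: k => [[[a2 b2] c2] e2] /=;
  by congr (_, _, _, _); rewrite ?negbK //; ring.
Qed.

Lemma K2mul1g g : K2mul K2one g = g.
Proof. by case: g => [[[a b] c] e] /=; congr (_, _, _, _); ring. Qed.

Lemma K2invM g h : K2inv (K2mul g h) = K2mul (K2inv h) (K2inv g).
Proof.
case: g => [[[a b] c] []]; case: h => [[[a' b'] c'] []] /=;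
  by congr (_, _, _, _); ring.
Qed.

Arguments K2mul : simpl never.

Definition letter_val (l : K2gen * bool) : int * int * int * bool :=
  match l with
  | (gx, false) => (1, 0, 0, false)
  | (gx, true) => (-1, 0, 0, false)
  | (gt, _) => (0, 0, 0, true)
  end.

Definition word_val w := foldr (fun l g => K2mul (letter_val l) g) K2one w.

Lemma word_val_cat u w : word_val (u ++ w) = K2mul (word_val u) (word_val w).
Proof. by elim: u => [|l u IH]; [rewrite K2mul1g|rewrite /= IH K2mulA]. Qed.

Lemma word_val_inv w : word_val (word_inv w) = K2inv (word_val w).
Proof.
elim: w => [|l w IH] //; rewrite -cat1s word_inv_cat !word_val_cat K2invM -IH.
by congr K2mul; case: l => [[] []].
Qed.

Lemma word_val_rel r : r \in K2_rels -> word_val r = K2one.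
Proof. by rewrite !inE => /orP[] /eqP ->. Qed.

Lemma word_val_step u w : pres_step K2_rels u w -> word_val u = word_val w.
Proof.
elim=> // [p q l|p q r H|p q r H]; rewrite !word_val_cat; last first.
- by rewrite word_val_inv (word_val_rel H) K2mul1g.
- by rewrite (word_val_rel H) K2mul1g.
by congr K2mul; case: l => [[] []]; rewrite /= K2mulA K2mul1g.
Qed.

(** The normal form is thus an invariant of elements of K_2; soundness of the encoding reads
    exponents off it. *)
Lemma word_val_eq u w : pres_eq K2_rels u w -> word_val u = word_val w.
Proof. by elim=> // w1 w2 w3 /word_val_step -> _ ->. Qed.

End K2Group.

#[local] Hint Extern 0 (pres_eq _ _ _) => exact (pe_refl _ _) : core.
#[local] Existing Instance pres_eq_equiv.
#[local] Existing Instance cat_pres_eq.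
#[local] Existing Instance word_inv_pres_eq.
#[local] Existing Instance conjby_pres_eq.

Local Notation "u ~~ v" := (pres_eq K2_rels u v) (at level 70).
Local Notation conj2 := (@conjby _ K2_rels).

Definition wx : word K2gen := [:: X].
Definition wt : word K2gen := [:: T].
Definition wy : word K2gen := [:: T; X; Ti].
Definition wz : word K2gen := wx ++ wy ++ word_inv wx ++ word_inv wy.

Lemma K2_conj_tx : conj2 wt wx wy.
Proof.
have := word_inv_catl K2_rels wt => E.
by rewrite /conjby (_ : wy ++ wt = (wt ++ wx) ++ (word_inv wt ++ wt)) // E cats0.
Qed.

Lemma K2_tt : wt ++ wt ~~ [::].
Proof.
apply: pres_eq_sym; apply: pres_step_eq.
by apply: (@ps_rel _ _ [::] [::] K2_rel2); rewrite !inE eqxx orbT.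
Qed.

Lemma K2_tinv : word_inv wt ~~ wt.
Proof. by rewrite -[word_inv wt]cats0 -K2_tt word_inv_catK. Qed.

Lemma K2_conj_ty : conj2 wt wy wx.
Proof. by rewrite -{1}K2_tinv; apply: conjby_sym; exact: K2_conj_tx. Qed.

Lemma K2_comm_x : conj2 wx (wy ++ wx ++ word_inv wy) (wy ++ wx ++ word_inv wy).
Proof.
apply/cat_word_inv_nil; apply: pres_eq_sym; apply: pres_step_eq.
by apply: (@ps_rel _ _ [::] [::] K2_rel1); rewrite !inE eqxx.
Qed.

(** Conjugation by t exchanges x and y, and so carries [K2_comm_x] to this relation. *)
Lemma K2_comm_y : conj2 wy (wx ++ wy ++ word_inv wx) (wx ++ wy ++ word_inv wx).
Proof.
have tx := K2_conj_tx; have ty := K2_conj_ty; have cx := K2_comm_x.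
have H : conj2 wt (wy ++ wx ++ word_inv wy) (wx ++ wy ++ word_inv wx).
  by apply: conjby_cat => //; apply: conjby_cat => //; apply: conjby_inv.
have H1 : conj2 (wt ++ wx) (wy ++ wx ++ word_inv wy) (wx ++ wy ++ word_inv wx).
  exact: conjby_comp cx H.
rewrite K2_conj_tx in H1.
have := conjby_comp (conjby_sym H) H1.
by rewrite -catA cat_word_inv cats0.
Qed.

(** z is x times the inverse of y x y^-1, and x commutes with both. For y the factors are x y x^-1
    and y^-1. *)
Lemma K2_wz_x : conj2 wx wz wz.
Proof.
apply: conjby_cat; first exact: pe_refl.
exact: (conjby_inv K2_comm_x).
Qed.

Lemma K2_wz_y : conj2 wy wz wz.
Proof.
rewrite /wz (_ : _ ++ _ = (wx ++ wy ++ word_inv wx) ++ word_inv wy) //.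
by apply: conjby_cat K2_comm_y _; apply: conjby_inv; exact: pe_refl.
Qed.

Lemma K2_conj_xy : conj2 wx wy (wz ++ wy).
Proof.
rewrite /conjby (_ : (wz ++ wy) ++ wx = wx ++ wy ++ word_inv wx ++ (word_inv wy ++ wy ++ wx)) //.
by rewrite word_inv_catK word_inv_catl cats0.
Qed.

Lemma K2_commutator a b :
  wpow wx a ++ wpow wy b ++ word_inv (wpow wx a) ++ word_inv (wpow wy b) ~~ wpow wz (a * b)%R.
Proof. exact: commutator_wpow K2_wz_x K2_wz_y K2_conj_xy. Qed.

(** * Interpreting arithmetic in the group *)

Lemma subst_cat s u w : subst s (u ++ w) = subst s u ++ subst s w.
Proof. by rewrite /subst map_cat flatten_cat. Qed.

Lemma subst_inv s w : subst s (word_inv w) = word_inv (subst s w).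
Proof.
elim: w => [|l w IH] //; rewrite -cat1s word_inv_cat !subst_cat word_inv_cat IH.
congr (_ ++ _); rewrite /subst /= !cats0.
by case: l => [[g|i] []] //=; rewrite word_invK.
Qed.

Definition evar i : equation := [:: (inr i, false)].
Definition ex : equation := [:: (inl gx, false)].
Definition et : equation := [:: (inl gt, false)].
Definition ey : equation := et ++ ex ++ word_inv et.
Definition eqn (u w : equation) : equation := u ++ word_inv w.
Definition ecomm (u w : equation) : equation := u ++ w ++ word_inv u ++ word_inv w.
Definition econj (u w : equation) : equation := u ++ w ++ word_inv u.
Definition ecent i : equation := eqn (evar i ++ ex) (ex ++ evar i).

(* An integer [a] is encoded by any element of the centralizer of [x] with [x]-exponent [a]. *)
Definition constr_eqs (c : constr) : eq_system :=
  match c with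
  | EOne i => [:: eqn (evar i) ex]
  | EAdd i j k => [:: ecent i; ecent j; ecent k;
      eqn (ecomm (evar i ++ evar j) ey) (ecomm (evar k) ey)]
  | EMul i j k => [:: ecent i; ecent j; ecent k;
      eqn (ecomm (evar i) (econj et (evar j))) (ecomm (evar k) ey)]
  end.

(** Writing v_0^-1 first leaves a fixed letter followed by a constant list, whose code has a closed
    form in k. *)
Definition param_eq k : equation := (inr 0, true) :: nseq k (inl gx, false).
Definition K2_system (l : seq constr) : eq_system := flatten (map constr_eqs l).

Definition solves s (S : eq_system) := forall e, e \in S -> subst s e ~~ [::].

Lemma solves_cons s e S : solves s (e :: S) <-> subst s e ~~ [::] /\ solves s S.
Proof.
split=> [H|[He HS] e']; last by rewrite inE => /predU1P[->|/HS].
by split=> [|e' He']; apply: H; rewrite inE ?eqxx // He' orbT.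
Qed.

Lemma solves_cat s S1 S2 : solves s (S1 ++ S2) <-> solves s S1 /\ solves s S2.
Proof.
split=> [H|[H1 H2] e]; last by rewrite mem_cat => /orP[/H1|/H2].
by split=> e He; apply: H; rewrite mem_cat He ?orbT.
Qed.

Lemma subst_eqn s u w : subst s (eqn u w) ~~ [::] <-> subst s u ~~ subst s w.
Proof. by rewrite subst_cat subst_inv cat_word_inv_nil. Qed.

Lemma subst_ecomm s u w : subst s (ecomm u w) =
  subst s u ++ subst s w ++ word_inv (subst s u) ++ word_inv (subst s w).
Proof. by rewrite !subst_cat !subst_inv. Qed.

Lemma subst_econj s u w : subst s (econj u w) = subst s u ++ subst s w ++ word_inv (subst s u).
Proof. by rewrite !subst_cat !subst_inv. Qed.

Section Values.
Local Open Scope ring_scope.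
Variable s : nat -> word K2gen.

Definition xcoord (i : nat) : int := (word_val (s i)).1.1.1.

Let evarE i : subst s (evar i) = s i.
Proof. by rewrite /subst /= cats0. Qed.

(** If t occurs, multiplication by x on the right raises the y-exponent and on the left the
    x-exponent. Otherwise the two products differ by b in the z-exponent, b being the y-exponent. *)
Lemma ecent_val i : subst s (ecent i) ~~ [::] ->
  exists c, word_val (s i) = (xcoord i, 0, c, false).
Proof.
move=> /subst_eqn; rewrite !subst_cat evarE => /word_val_eq.
rewrite !word_val_cat /xcoord; case: (word_val (s i)) => [[[a b] c] e].
rewrite /K2mul /=; case: e => -[].
  by lia.
by move=> _ _ E; exists c; congr (_, _, _, _); lia.
Qed.

(** For w = x^a z^c the commutator with y is z^a, and with the t-conjugate of an element of
    x-exponent b it is z^(ab). Comparing z-exponents gives the arithmetic relation, whatever the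
    central parts are. *)
Lemma constr_eqs_sound c : solves s (constr_eqs c) -> holds 1 +%R *%R xcoord c.
Proof.
case: c => [i|i j k|i j k]; rewrite /constr_eqs !solves_cons.
- move=> [/subst_eqn/word_val_eq + _]; rewrite evarE => E.
  by rewrite /= /xcoord E.
- move=> [/ecent_val[ci Ei] [/ecent_val[cj Ej] [/ecent_val[ck Ek] [/subst_eqn/word_val_eq + _]]]].
  rewrite !subst_cat !subst_inv !subst_cat !evarE !word_val_cat !word_val_inv !word_val_cat Ei Ej Ek /=.
  by case=> E; move: E; rewrite /=; lia.
- move=> [/ecent_val[ci Ei] [/ecent_val[cj Ej] [/ecent_val[ck Ek] [/subst_eqn/word_val_eq + _]]]].
  rewrite !subst_cat !subst_inv !subst_cat !evarE !word_val_cat !word_val_inv !word_val_cat Ei Ej Ek /=.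
  by case=> E; move: E; rewrite /=; lia.
Qed.

End Values.

Lemma constr_eqs_complete (v : nat -> int) c : holds 1%R +%R *%R v c ->
  solves (fun i => wpow wx (v i)) (constr_eqs c).
Proof.
set s := fun i => _.
have evarE i : subst s (evar i) = wpow wx (v i) by rewrite /subst /= cats0.
have cent i : subst s (ecent i) ~~ [::].
  apply/subst_eqn; rewrite !subst_cat evarE; symmetry.
  exact: (@conjby_wpow _ _ wx wx wx (v i) (pe_refl _ _)).
have yE : subst s ey = wy by [].
have comm1 a : wpow wx a ++ wy ++ word_inv (wpow wx a) ++ word_inv wy ~~ wpow wz a.
  by have := K2_commutator a 1; rewrite mulr1.
case: c => [i|i j k|i j k]; rewrite [holds _ _ _ _ _]/= /constr_eqs => E; rewrite !solves_cons.
- by split=> //; apply/subst_eqn; rewrite evarE E.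
- do 3 (split; first exact: cent); split=> //; apply/subst_eqn.
  by rewrite !subst_ecomm yE subst_cat !evarE -wpowD E.
- do 3 (split; first exact: cent); split=> //; apply/subst_eqn.
  rewrite !subst_ecomm yE subst_econj !evarE comm1.
  by rewrite (conjbyE (conjby_wpow (v j) K2_conj_tx)) K2_commutator E.
Qed.

Lemma subst_param s k : subst s (param_eq k) ~~ [::] <-> s 0 ~~ wpow wx (Posz k).
Proof.
have -> : subst s (param_eq k) = word_inv (s 0) ++ wpow wx (Posz k).
  by rewrite /subst /=; congr (_ ++ _); elim: k => //= k ->.
split=> [H|->]; last exact: word_inv_catl.
by rewrite -[s 0]cats0 -H cat_word_invK.
Qed.

Lemma word_val_wpow (k : nat) : word_val (wpow wx (Posz k)) = (Posz k, 0, 0, false)%R.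
Proof.
elim: k => // k; rewrite /= => ->; rewrite /K2mul /=.
by congr (_, _, _, _); lia.
Qed.

Lemma K2_solvable_zsat l k : K2_solvable (param_eq k :: K2_system l) <->
  exists v : nat -> int, v 0 = Posz k /\ zsat v l.
Proof.
split=> [[s /solves_cons[/subst_param E H]]|[v [v0 H]]].
  exists (xcoord s); split; first by rewrite /xcoord (word_val_eq E) word_val_wpow.
  elim: l H => //= c l IH /solves_cat[/constr_eqs_sound Hc /IH Hl]; by split.
exists (fun i => wpow wx (v i)); apply/solves_cons; split.
  by apply/subst_param; rewrite v0.
by elim: l H => //= c l IH [/constr_eqs_complete Hc /IH Hl]; apply/solves_cat.
Qed.

(** * Codes of systems and diagonalization *)

Lemma pickle_seq_cons (Tc : countType) (x : Tc) (s : seq Tc) :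
  pickle (x :: s) = 2 ^ pickle x * (pickle s).*2.+1.
Proof. by []. Qed.

(** The code P of the list satisfies P_(k+1) = (a+1)(2 P_k + 1) with P_0 = 0, and this is the solved
    affine recurrence. *)
Lemma pickle_nseq (Tc : countType) (x : Tc) k a : 2 ^ pickle x = a.+1 ->
  pickle (nseq k x) * (a + a + 1) + a.+1 = a.+1 * (a + a + 1).+1 ^ k.
Proof.
move=> E; elim: k => [|k IH]; first by rewrite expn0 muln1.
rewrite [nseq _ _]/= pickle_seq_cons E -addnn expnS mulnCA -IH; lia.
Qed.

(** The map from the code of a system to the code of the system augmented by v_0 = x^k, with k that
    same code, is Diophantine; W below is the code of the list of k letters x. *)
Lemma nfun_pickle_diag : exists diag : nat -> nat, nfun (fun nu => diag (nu 0)) /\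
  forall S : eq_system, pickle (param_eq (pickle S) :: S) = diag (pickle S).
Proof.
pose x : eq_letter * bool := (inl gx, false).
pose p0 := pickle ((inr 0, true) : eq_letter * bool).
exists (fun k => 2 ^ (2 ^ p0 * (pickle (nseq k x)).*2.+1) * k.*2.+1); split; last by [].
have [a Ea] : exists a, 2 ^ pickle x = a.+1.
  by exists (2 ^ pickle x).-1; rewrite prednK // expn_gt0.
apply: (@dio_iff _ _ _ _ (fun nu => exists W,
   W * (a + a + 1) + a.+1 = a.+1 * (a + a + 1).+1 ^ nu 1 /\
   nu 0 = 2 ^ (2 ^ p0 * (W + W + 1)) * (nu 1 + nu 1 + 1))); first by ndio_tac.
move=> nu; split=> [[W [EW ->]]|->].
  have -> : pickle (nseq (nu 1) x) = W.
    have := pickle_nseq (nu 1) Ea; rewrite -EW => /eqP.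
    by rewrite eqn_add2r eqn_pmul2r ?addn1 // => /eqP.
  by rewrite -!addnn !addn1.
exists (pickle (nseq (nu 1) x)); rewrite pickle_nseq //.
by rewrite -!addnn !addn1.
Qed.

Theorem theorem4p3 : ~ K2_diophantine_decidable.
Proof.
move=> [f Hf]; have [diag [Hdiag diagE]] := nfun_pickle_diag.
(* The list [l] defines the set of k for which f outputs 0 on the augmented system with code
   [diag k]. *)
have [l Hl] : exists l, forall k, evalrf f [:: diag k] 0 <->
    exists v : nat -> int, v 0 = Posz k /\ zsat v l.
  apply: ndio_zsat; apply: (@dio_iff _ _ _ _ (fun nu => exists y z,
    y = diag (nu 0) /\ z = 0 /\ evalrf f [:: y] z)); last first.
    move=> nu; split=> [[y [z [-> [-> //]]]]|H].
    by exists (diag (nu 0)), 0.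
  do 2 apply: dio_ex; apply: dio_and.
    by apply: ndio_eq; [nfun_tac|exact: (dfun_ren (fun=> 2) Hdiag)].
  apply: dio_and; first by ndio_tac.
  exact: (graph_dio_ren 1 (fun=> 1) 0 (graph_dio_recfun f)).
pose S := K2_system l.
(* Self-reference: k is the code of the very system S that defines the set. *)
have {}Hl : K2_solvable (param_eq (pickle S) :: S) <->
    evalrf f [:: pickle (param_eq (pickle S) :: S)] 0.
  by rewrite K2_solvable_zsat diagE Hl.
have [Hyes Hno] := Hf (param_eq (pickle S) :: S).
(* A solution would make f output 1 by correctness and 0 by the choice of S. *)
have ns : ~ K2_solvable (param_eq (pickle S) :: S).
  by move=> H; have := evalrf_det (Hyes H) (proj1 Hl H).
exact/ns/Hl/Hno.
Qed.
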